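(* Let $S,\sigma:\mathbb{R}\to\mathbb{R}$ satisfy A1, let $X=X^\varepsilon$ be the solution of $$X_t=x_0+\int_0^t S(X_s)\,ds+\varepsilon\int_0^t\sigma(X_s)\,dW_s,\quad t\in[0,T],$$ observed according to the Sampling Scheme, and assume $\sup_{s\in[0,T]}E|X_s|^4<\infty$ (for each $\varepsilon$). Then $$\widehat\Sigma^\varepsilon=\sqrt{\varepsilon^{-2}\sum_{i=1}^{n(\varepsilon)}|X_{t_i^\varepsilon}-X_{t_{i-1}^\varepsilon}|^2}$$ is a consistent estimator for $\Sigma_{S,\sigma}=\sqrt{\int_0^T\sigma(x_t^S)^2dt}$, i.e. $\widehat\Sigma^\varepsilon\to\Sigma_{S,\sigma}$ in probability as $\varepsilon\downarrow0$.
   Context: Setting: $T>0$ and $x_0\in\mathbb{R}$ are fixed; $W$ is a standard Wiener process on a stochastic basis $(\Omega,\mathcal F,(\mathcal F_t)_{t\in[0,T]},P)$; $X=X^\varepsilon$ is the unique strong solution of the displayed SDE for each $\varepsilon>0$ (the dependence on $\varepsilon$ is suppressed). $x^S$ denotes the solution of $dx^S_t/dt=S(x^S_t)$, $x^S_0=x_0$, on $[0,T]$. A1: there is $C>0$ with $|S(x)-S(y)|\le C|x-y|$ and $|\sigma(x)-\sigma(y)|\le C|x-y|$ for all $x,y\in\mathbb{R}$. Sampling Scheme: for each $\varepsilon$, $X$ is observed at deterministic times $0=t_0^\varepsilon<t_1^\varepsilon<\cdots<t_{n(\varepsilon)}^\varepsilon=T$ such that $h_\varepsilon:=\max_{1\le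 i\le n(\varepsilon)}|t_i^\varepsilon-t_{i-1}^\varepsilon|=o(\varepsilon^2)$ as $\varepsilon\downarrow0$. *)

(* Defs.v *)
From HB Require Import structures.
From mathcomp Require Import all_boot all_order all_algebra.
From mathcomp Require Import all_classical all_reals all_analysis.
Import Order.TTheory GRing.Theory Num.Theory.
Import numFieldNormedType.Exports.

Set Implicit Arguments.
Unset Strict Implicit.
Unset Printing Implicit Defensive.

Local Open Scope classical_set_scope.
Local Open Scope ring_scope.

Definition is_lipschitz (R : realType) (C : R) (f : R -> R) : Prop :=
  forall x y, `|f x - f y| <= C * `|x - y|.

(* Only the values t 0, ..., t n matter. *)
Definition is_partition (R : realType) (T : R) (n : nat) (t : nat -> R) : Prop :=
  [/\ t 0%N = 0, t n = T & forall i, (i < n)%N -> t i < t i.+1].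

Definition mesh (R : realType) (n : nat) (t : nat -> R) : R :=
  \big[Num.max/0]_(i < n) `|t i.+1 - t i|.

Definition ode_solution (R : realType) (T x0 : R) (S x : R -> R) : Prop :=
  [/\ x 0 = x0, {within `[0, T], continuous x} &
      forall t : R, 0 < t < T -> is_derive t 1 x (S (x t))].

Section Stochastic.
Context (d : measure_display) (Omega : measurableType d) (R : realType).
Context (P : probability Omega R).

(* The event is measurable as soon as the X j and Y are random variables. *)
Definition cvg_in_probability (J : Type) (G : set_system J)
    (X : J -> Omega -> R) (Y : Omega -> R) : Prop :=
  forall delta : R, 0 < delta ->
    P [set w | delta < `|X j w - Y w|] @[j --> G] --> 0%E.

(* Processes and filtrations are indexed by all of R, but only times in [0, T]
   are ever looked at. Neither completeness nor right-continuity of the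
   filtration is imposed. *)
Definition is_filtration (T : R) (F : R -> set (set Omega)) : Prop :=
  [/\ forall t : R, 0 <= t <= T -> sigma_algebra setT (F t),
      forall t : R, 0 <= t <= T -> F t `<=` measurable &
      forall s t : R, 0 <= s -> s <= t -> t <= T -> F s `<=` F t].

Definition rv_measurable (G : set (set Omega)) (Y : Omega -> R) : Prop :=
  measurable_fun setT (Y : g_sigma_algebraType G -> R).

Definition continuous_adapted (T : R) (F : R -> set (set Omega))
    (X : R -> Omega -> R) : Prop :=
  (forall w, {within `[0, T], continuous (fun t => X t w)}) /\
  (forall t : R, 0 <= t <= T -> rv_measurable (F t) (X t)).

(* The second parameter of normal_prob is the standard deviation. *)
Record is_wiener (T : R) (F : R -> set (set Omega)) (W : R -> Omega -> R)
    : Prop := IsWiener {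
  wiener_cont_adapted : continuous_adapted T F W ;
  wiener_start : {ae P, forall w, W 0 w = 0} ;
  wiener_normal : forall s t : R, 0 <= s -> s < t -> t <= T ->
    forall B : set R, measurable B ->
      pushforward P (fun w => W t w - W s w) B =
      normal_prob 0 (Num.sqrt (t - s)) B ;
  wiener_indep : forall s t : R, 0 <= s -> s < t -> t <= T ->
    forall (A : set Omega) (B : set R), F s A -> measurable B ->
      let E := [set w | B (W t w - W s w)] in
      P (A `&` E) = (P A * P E)%E }.

(* Represents sum_(i < sp_size) sp_coef i * 1_(]sp_time i, sp_time i.+1]). *)
Record simple_process := SimpleProcess {
  sp_size : nat ;
  sp_time : nat -> R ;
  sp_coef : nat -> Omega -> R }.

Definition is_simple (T : R) (F : R -> set (set Omega)) (Z : simple_process)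
    : Prop :=
  is_partition T (sp_size Z) (sp_time Z) /\
  forall i, (i < sp_size Z)%N ->
    rv_measurable (F (sp_time Z i)) (sp_coef Z i) /\
    exists M : R, forall w, `|sp_coef Z i w| <= M.

Definition simple_value (Z : simple_process) (t : R) (w : Omega) : R :=
  \sum_(i < sp_size Z)
    sp_coef Z i w * (sp_time Z i < t <= sp_time Z i.+1)%R%:R.

Definition simple_integral (W : R -> Omega -> R) (Z : simple_process)
    (t : R) (w : Omega) : R :=
  \sum_(i < sp_size Z) sp_coef Z i w *
    (W (Num.min (sp_time Z i.+1) t) w - W (Num.min (sp_time Z i) t) w).

(* I is (a continuous version of) t |-> int_0^t H_s dW_s on [0, T], for W a
   Wiener process and H a continuous adapted integrand: I is the limit,
   uniformly on [0, T] in probability, of the integrals of simple processes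
   Z_k such that int_0^T (Z_k - H)^2 ds -> 0 in probability. *)
Definition is_ito_integral (T : R) (F : R -> set (set Omega))
    (W H I : R -> Omega -> R) : Prop :=
  [/\ continuous_adapted T F H,
      continuous_adapted T F I &
      exists Z : nat -> simple_process,
        [/\ forall k, is_simple T F (Z k),
            cvg_in_probability \oo
              (fun k w => \int[@lebesgue_measure R]_(s in `[0, T])
                            (simple_value (Z k) s w - H s w) ^+ 2)
              (cst 0) &
            cvg_in_probability \oo
              (fun k w => sup [set `|simple_integral W (Z k) t w - I t w|
                              | t in `[0, T]])
              (cst 0)]].

(* X_t = x0 + int_0^t S(X_s) ds + eps int_0^t sigma(X_s) dW_s on [0, T],
   on the given basis and with the given Wiener process. *)
Definition sde_solution (T x0 eps : R) (F : R -> set (set Omega))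
    (W : R -> Omega -> R) (S sigma : R -> R) (X : R -> Omega -> R) : Prop :=
  continuous_adapted T F X /\
  exists I : R -> Omega -> R,
    is_ito_integral T F W (fun t w => sigma (X t w)) I /\
    {ae P, forall w, forall t : R, 0 <= t <= T ->
       X t w = x0 + \int[@lebesgue_measure R]_(s in `[0, t]) S (X s w)
               + eps * I t w}.

End Stochastic.

Definition Sigma_hat (R : realType) (Omega : Type) (eps : R) (n : nat)
    (t : nat -> R) (X : R -> Omega -> R) (w : Omega) : R :=
  Num.sqrt (eps ^- 2 * \sum_(i < n) `|X (t i.+1) w - X (t i) w| ^+ 2).

Definition Sigma_limit (R : realType) (T : R) (sigma xS : R -> R) : R :=
  Num.sqrt (\int[@lebesgue_measure R]_(t in `[0, T]) (sigma (xS t)) ^+ 2).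

(* Main.v *)
Require Import Defs.
From HB Require Import structures.
From mathcomp Require Import all_boot all_order all_algebra.
From mathcomp Require Import all_classical all_reals all_analysis.
From mathcomp Require Import measurable_realfun ring lra.
Import Order.TTheory GRing.Theory Num.Theory.
Import numFieldNormedType.Exports.

Local Open Scope classical_set_scope.
Local Open Scope ring_scope.

Set Implicit Arguments.
Unset Strict Implicit.
Unset Printing Implicit Defensive.

(** Write X_t = x0 + int_0^t S(X) ds + eps I_t with I the stochastic integral
of sigma(X). Up to the factor eps^-1, the estimator is the Euclidean norm of
the vector of increments of X over the observation times. It is compared with
the norm of the vector of the g_i (W_{t_{i+1}} - W_{t_i}), where
g_i = sigma(xS_{t_i}). By the triangle inequality for the Euclidean norm the
two differ by at most the norms of
- the drift increments over eps, whose squares sum to O(h / eps^2) = o(1);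
- the increments of I - N, where N is the integral of a simple process Z that
  approximates sigma(X), negligible by the choice of Z (for each eps, after the
  number of observations is known);
- the increments of N minus the g_i (W_{t_{i+1}} - W_{t_i}), that is, of the
  integral of Z - g, which are small as soon as int_0^T (Z - g)^2 ds is.
Finally sum_i g_i^2 (W_{t_{i+1}} - W_{t_i})^2 concentrates by Chebyshev around
the Riemann sum sum_i g_i^2 (t_{i+1} - t_i), which tends to the integral of
sigma(xS)^2.

All the probability takes place at the level of simple processes. On a grid
containing every time of interest the integral of a simple process is a
martingale transform, for which the isometry is elementary
([transform_isometry]). Applied to a stopped or truncated integrand, the
isometry yields two localized inequalities: a transform whose bracket stays
below b exceeds a with probability at most b / a^2 ([transform_maximal]), and
the squares of its increments over blocks sum to more than delta while the
bracket stays below b with probability at most b / delta ([transform_blocks]).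

The localization is what makes X close to xS. As long as |X - xS| <= 1, the
integrand sigma(X) is bounded by a deterministic constant, so the maximal
inequality bounds I by a constant up to that time; Gronwall then gives
|X - xS| = O(eps), hence |X - xS| < 1, and the path never gets to distance 1
([perturbation_bootstrap]). These pathwise arguments are gathered in
[sigma_hat_close], which says that outside of a few explicit events the
estimator is within delta of its limit; [Sigma_hat_deviation] bounds the
probability of these events for a given eps. *)

(** * Real-valued integrals and measures with a density *)

Section integrable_EFin.
Context d (T : measurableType d) (R : realType).
Variables (mu : {measure set T -> \bar R}) (D : set T) (mD : measurable D).
Implicit Types f g : T -> R.

Lemma integrable_EFinZl (k : R) f : mu.-integrable D (EFin \o f) ->
  mu.-integrable D (EFin \o (fun x => k * f x)).
Proof. by move=> fi; exact: (integrableZl mD k fi). Qed.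

Lemma integrable_EFinD f g :
  mu.-integrable D (EFin \o f) -> mu.-integrable D (EFin \o g) ->
  mu.-integrable D (EFin \o (fun x => f x + g x)).
Proof. by move=> fi gi; exact: (integrableD mD fi gi). Qed.

Lemma integrable_EFinB f g :
  mu.-integrable D (EFin \o f) -> mu.-integrable D (EFin \o g) ->
  mu.-integrable D (EFin \o (fun x => f x - g x)).
Proof. by move=> fi gi; exact: (integrableB mD fi gi). Qed.

Lemma integrable_EFin_le f g : measurable_fun D f ->
  (forall x, D x -> `|f x| <= g x) -> mu.-integrable D (EFin \o g) ->
  mu.-integrable D (EFin \o f).
Proof.
move=> mf fg gi; apply: (le_integrable mD _ _ gi).
  exact/measurable_EFinP.
by move=> x Dx /=; rewrite lee_fin (le_trans (fg _ Dx))// ler_norm.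
Qed.

Lemma integrable_EFin_sum I (s : seq I) (f : I -> T -> R) :
  (forall i, mu.-integrable D (EFin \o f i)) ->
  mu.-integrable D (EFin \o (fun x => \sum_(i <- s) f i x)).
Proof.
move=> fi; have := @integrable_sum _ _ _ mu D mD I s xpredT
  (fun i => EFin \o f i) (fun i _ => fi i).
by apply: eq_integrable => // x _; rewrite sumEFin.
Qed.

Lemma Rintegral_sum I (s : seq I) (f : I -> T -> R) :
  (forall i, mu.-integrable D (EFin \o f i)) ->
  \int[mu]_(x in D) (\sum_(i <- s) f i x) =
  \sum_(i <- s) \int[mu]_(x in D) f i x.
Proof.
move=> fi; elim: s => [|i s ih].
  under eq_Rintegral do rewrite big_nil.
  by rewrite big_nil Rintegral_cst// mul0r.
under eq_Rintegral do rewrite big_cons.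
rewrite RintegralD//; last exact: integrable_EFin_sum.
by rewrite big_cons ih.
Qed.

End integrable_EFin.

Section density.
Context d (T : measurableType d) (R : realType).
Variables (mu nu : {measure set T -> \bar R}) (p : T -> R).
Hypotheses (mp : measurable_fun setT p) (p0 : forall x, 0 <= p x).
Hypothesis nuE : forall A, measurable A -> nu A = (\int[mu]_(x in A) (p x)%:E)%E.

Import HBNNSimple.

Let ge0_integral_density_nnsfun (f : {nnsfun T >-> R}) :
  (\int[nu]_x (f x)%:E = \int[mu]_x ((f x)%:E * (p x)%:E))%E.
Proof.
under [LHS]eq_integral do rewrite fimfunE -fsumEFin//.
rewrite [LHS]ge0_integral_fsum//; last 2 first.
  - by move=> r; exact/measurable_EFinP/measurableT_comp.
  - by move=> n x _; rewrite EFinM nnfun_muleindic_ge0.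
under [RHS]eq_integral.
  move=> x xD; rewrite fimfunE -fsumEFin// ge0_mule_fsuml; last first.
    by move=> r; rewrite EFinM nnfun_muleindic_ge0.
  over.
rewrite [RHS]ge0_integral_fsum//; last 2 first.
  - move=> r; apply: emeasurable_funM => //.
      by apply/measurable_EFinP; apply/measurableT_comp.
    exact/measurable_EFinP.
  - move=> n x _; apply: mule_ge0; last by rewrite lee_fin.
    by rewrite EFinM nnfun_muleindic_ge0.
apply: eq_fsbigr => r _.
rewrite integralZl_indic_nnsfun//= integral_indic// setIT nuE//.
transitivity (\int[mu]_x (r%:E * ((\1_(f @^-1` [set r]) x)%:E * (p x)%:E)))%E.
  have [r0|r0] := leP 0 r.
    rewrite ge0_integralZl//.
    - rewrite (integral_mkcond (f @^-1` [set r])); congr (_ * _)%E.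
      apply: eq_integral => x _; rewrite patchE indicE.
      by case: (_ \in _); rewrite ?mul1e ?mul0e.
    - by apply: emeasurable_funM => //; apply/measurable_EFinP.
    - by move=> x _; rewrite mule_ge0// lee_fin.
  rewrite preimage_nnfun0// integral_set0 mule0.
  rewrite (eq_integral (cst 0%E)) ?integral0// => x _.
  by rewrite indic0 mul0e mule0.
by apply: eq_integral => x _; rewrite muleA EFinM.
Qed.

(** Both sides agree on simple functions; the general case follows by monotone
convergence. *)
Lemma ge0_integral_density (f : T -> \bar R) :
  measurable_fun setT f -> (forall x, (0 <= f x)%E) ->
  (\int[nu]_x f x = \int[mu]_x (f x * (p x)%:E))%E.
Proof.
move=> mf f0; pose f_ := nnsfun_approx measurableT mf.
transitivity (lim (\int[nu]_x (f_ n x)%:E @[n --> \oo])%E).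
  rewrite -monotone_convergence//=.
  - apply: eq_integral => ? /[!inE] xD; apply/esym/cvg_lim => //=.
    exact: cvg_nnsfun_approx.
  - by move=> n; exact/measurable_EFinP/measurable_funTS.
  - by move=> n ? _; rewrite lee_fin.
  - by move=> ? _ ? ? mn; rewrite lee_fin; exact/lefP/nd_nnsfun_approx.
under eq_fun do rewrite ge0_integral_density_nnsfun.
rewrite -monotone_convergence//=.
- apply: eq_integral => x _; apply/cvg_lim => //=.
  by apply: cvgeZr => //; exact: cvg_nnsfun_approx.
- by move=> n; apply: emeasurable_funM; exact/measurable_EFinP.
- by move=> n x _; rewrite -EFinM lee_fin mulr_ge0.
- move=> x _ m n mn; rewrite -!EFinM lee_fin ler_wpM2r//.
  exact/lefP/nd_nnsfun_approx.
Qed.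

Lemma integral_density (f : T -> R) : measurable_fun setT f ->
  mu.-integrable setT (fun x => (f x * p x)%:E) ->
  nu.-integrable setT (EFin \o f) /\
  (\int[nu]_x (f x)%:E = \int[mu]_x (f x * p x)%:E)%E.
Proof.
move=> mf fp; split.
  apply/integrableP; split; first exact/measurable_EFinP.
  rewrite ge0_integral_density//=; last first.
    by apply/measurable_EFinP; exact: measurableT_comp.
  have /integrableP[_] := fp.
  under eq_integral do rewrite abse_EFin normrM (ger0_norm (p0 _)) EFinM.
  by [].
rewrite [LHS]integralE [RHS]integralE; congr (_ - _)%E.
- rewrite ge0_integral_density//=; last first.
    exact/measurable_funepos/measurable_EFinP.
  apply: eq_integral => x _.
  by rewrite !funeposE -!EFin_max -EFinM maxr_pMl// mul0r.
- rewrite ge0_integral_density//=; last first.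
    exact/measurable_funeneg/measurable_EFinP.
  apply: eq_integral => x _.
  by rewrite !funenegE -!EFinN -!EFin_max -EFinM maxr_pMl// mul0r mulNr.
Qed.
End density.

(** * Moments of the normal distribution *)

(** The polynomial moments used below are all controlled by the fourth one. *)
Section quartic_bounds.
Context (R : realFieldType).
Implicit Types x : R.

Lemma norm_le_1D4 x : `|x| <= 1 + x ^+ 4.
Proof.
rewrite ler_norml; apply/andP; split.
  have := sqr_ge0 (x ^+ 2 - 4^-1); have := sqr_ge0 (x + 1); nra.
have := sqr_ge0 (x ^+ 2 - 4^-1); have := sqr_ge0 (x - 1); nra.
Qed.

Lemma sqr_le_1D4 x : `|x ^+ 2| <= 1 + x ^+ 4.
Proof. rewrite ger0_norm ?sqr_ge0//; have := sqr_ge0 (x ^+ 2 - 1); nra. Qed.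

Lemma fourth_le_1D4 x : `|x ^+ 4| <= 1 + x ^+ 4.
Proof. by rewrite ger0_norm ?exprn_even_ge0// lerDr. Qed.

End quartic_bounds.

Section normal_moments.
Context (R : realType).
Implicit Types s l x : R.
Local Notation mu := (@lebesgue_measure R).

(** Rescaling the standard deviation multiplies the density by the exponential
of a multiple of x^2. Since e^u >= 1 + u, comparing two densities thus gives
inequalities on moments, without any integration by parts. *)
Lemma normal_pdf_scale s l x : 0 < s -> 0 < l ->
  normal_pdf 0 (l * s) x =
  normal_pdf 0 s x / l * expR ((1 - l ^- 2) * (x ^+ 2 / (s ^+ 2 *+ 2))).
Proof.
move=> s0 l0; rewrite !normal_pdfE ?gt_eqF ?mulr_gt0//.
rewrite /normal_peak /normal_fun subr0.
have -> : (l * s) ^+ 2 * pi *+ 2 = l ^+ 2 * (s ^+ 2 * pi *+ 2).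
  by rewrite exprMn -mulrA mulrnAr.
rewrite sqrtrM ?sqr_ge0// sqrtr_sqr gtr0_norm// invfM.
have -> : - x ^+ 2 / ((l * s) ^+ 2 *+ 2) =
    - x ^+ 2 / (s ^+ 2 *+ 2) + (1 - l ^- 2) * (x ^+ 2 / (s ^+ 2 *+ 2)).
  by field; rewrite !gt_eqF.
rewrite expRD; ring.
Qed.

(** The density of doubled standard deviation gains a factor e^u with u a
multiple of x^2 / s^2, and e^u >= u^2 / 4 absorbs x^4. *)
Lemma normal_pdf_fourth s x : 0 < s ->
  x ^+ 4 * normal_pdf 0 s x <= 57 * s ^+ 4 * normal_pdf 0 (2 * s) x.
Proof.
move=> s0; rewrite normal_pdf_scale//.
set u := (_ * (_ / _)).
have u0 : 0 <= u.
  rewrite mulr_ge0//; first lra.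
  by rewrite divr_ge0 ?sqr_ge0// mulrn_wge0// sqr_ge0.
have eu : u ^+ 2 / 4 <= expR u.
  have -> : u = u / 2 + u / 2 by lra.
  rewrite expRD -expr2.
  have : (u / 2) ^+ 2 <= expR (u / 2) ^+ 2.
    rewrite ler_sqr ?nnegrE ?expR_ge0//; last by rewrite divr_ge0.
    by rewrite (le_trans _ (expR_ge1Dx _))// lerDr.
  by apply: le_trans; rewrite le_eqVlt; apply/orP; left; apply/eqP; field.
have -> : x ^+ 4 * normal_pdf 0 s x =
   512 / 9 * s ^+ 4 * (normal_pdf 0 s x / 2 * (u ^+ 2 / 4)).
  by rewrite /u; field; rewrite gt_eqF.
apply: ler_pM.
- by rewrite mulr_ge0// ?exprn_ge0// ?ltW//.
- rewrite mulr_ge0// ?divr_ge0 ?normal_pdf_ge0//.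
  by rewrite sqr_ge0.
- by rewrite ler_wpM2r ?exprn_ge0 ?ltW//; lra.
- by rewrite ler_wpM2l// divr_ge0 ?normal_pdf_ge0.
Qed.

Variable s : R.
Hypothesis s0 : 0 < s.
Local Notation q := (normal_pdf 0 s).

Lemma integrable_normal_pdfM (f : R -> R) : measurable_fun setT f ->
  (forall x, `|f x| <= 1 + x ^+ 4) ->
  mu.-integrable setT (fun x => (f x * q x)%:E).
Proof.
move=> mf fle.
apply: (@le_integrable _ _ _ mu setT measurableT _ ((fun x => (q x)%:E)
    \+ (fun x => (57 * s ^+ 4)%:E * (normal_pdf 0 (2 * s) x)%:E))%E) => //.
- apply/measurable_EFinP/measurable_funM => //.
  exact: measurable_normal_pdf.
- move=> x _ /=; rewrite lee_fin.
  have p0 := normal_pdf_ge0 0 s x.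
  have p1 := normal_pdf_ge0 0 (2 * s) x.
  have s4 : 0 <= s ^+ 4 by rewrite exprn_ge0// ltW.
  rewrite normrM (ger0_norm p0) [leRHS]ger0_norm; last first.
    by apply: addr_ge0 => //; apply: mulr_ge0 => //; apply: mulr_ge0.
  rewrite (le_trans (ler_wpM2r p0 (fle x)))// mulrDl mul1r lerD2l.
  exact: normal_pdf_fourth.
- apply: integrableD => //; first exact: integrable_normal_pdf.
  by apply: integrable_EFinZl => //; exact: integrable_normal_pdf.
Qed.

Local Notation E f := (\int[mu]_x (f x * q x)%R).

Let i0 : mu.-integrable setT (EFin \o q) := integrable_normal_pdf 0 s.
Let i1 : mu.-integrable setT (fun x => (x * q x)%:E).
Proof. by apply: (@integrable_normal_pdfM id) => //; exact: norm_le_1D4. Qed.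
Let i2 : mu.-integrable setT (fun x => (x ^+ 2 * q x)%:E).
Proof.
by apply: (@integrable_normal_pdfM (fun x => x ^+ 2)) => //; exact: sqr_le_1D4.
Qed.
Let i4 : mu.-integrable setT (fun x => (x ^+ 4 * q x)%:E).
Proof.
by apply: (@integrable_normal_pdfM (fun x => x ^+ 4)) => //; exact: fourth_le_1D4.
Qed.

Let Eq1 m s' : \int[mu]_x normal_pdf m s' x = 1.
Proof. by rewrite /Rintegral integral_normal_pdf. Qed.

(* a + b E[f] is at most the total mass 1 of any normal density dominating
   (a + b f) q. *)
Let lin_bound (f : R -> R) (m s' a b : R) :
  mu.-integrable setT (fun x => (f x * q x)%:E) ->
  (forall x, (a + b * f x) * q x <= normal_pdf m s' x) ->
  a + b * E f <= 1.
Proof.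
move=> fi fle; rewrite -(Eq1 m s').
have <- : \int[mu]_x (a * q x + b * (f x * q x)) = a + b * E f.
  rewrite RintegralD//; last 2 first.
  - exact: integrable_EFinZl.
  - exact: integrable_EFinZl.
  rewrite !RintegralZl//.
  by rewrite Eq1 mulr1.
apply: le_Rintegral => //.
- apply: integrable_EFinD => //; exact: integrable_EFinZl.
- exact: integrable_normal_pdf.
- by move=> x _; rewrite (le_trans _ (fle x))// mulrDl mulrA.
Qed.

(** The density centered at m dominates q (1 + m x / s^2 - m^2 / (2 s^2)), so
m E[x] <= m^2 / 2 for every real m, which forces E[x] = 0. *)
Lemma normal_mean : E (fun x => x) = 0.
Proof.
have H m : m * E (fun x => x) <= m ^+ 2 / 2.
  have : (1 - m ^+ 2 / (s ^+ 2 *+ 2)) + (m / s ^+ 2) * E (fun x => x) <= 1.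
    apply: (@lin_bound (fun x => x) m s) => // x.
    rewrite !normal_pdfE ?gt_eqF// mulrCA ler_wpM2l ?normal_peak_ge0//.
    rewrite /normal_fun subr0.
    have -> : - (x - m) ^+ 2 / (s ^+ 2 *+ 2) =
      - x ^+ 2 / (s ^+ 2 *+ 2) + (m / s ^+ 2 * x - m ^+ 2 / (s ^+ 2 *+ 2)).
      by field; rewrite gt_eqF.
    rewrite expRD mulrC ler_wpM2l ?expR_ge0//.
    by apply: le_trans (expR_ge1Dx _); lra.
  rewrite -addrA -lerBrDl subrr addrC subr_le0 => h.
  have := ler_wpM2r (sqr_ge0 s) h.
  have -> : m / s ^+ 2 * E (fun x => x) * s ^+ 2 = m * E (fun x => x).
    by field; rewrite gt_eqF.
  by have -> : m ^+ 2 / (s ^+ 2 *+ 2) * s ^+ 2 = m ^+ 2 / 2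
    by field; rewrite gt_eqF.
move: H; set e := E _ => H.
(* Taking m := E[x] gives E[x]^2 <= E[x]^2 / 2. *)
apply/eqP; rewrite -sqrf_eq0 eq_le sqr_ge0 andbT.
have := H e; have := sqr_ge0 e; nra.
Qed.

(** Comparing with the density of standard deviation l s gives
(1 + l) E[x^2] <= 2 l^2 s^2 for l > 1 and the converse for l < 1; both bounds
tend to s^2 as l tends to 1. *)
Lemma normal_second_moment : E (fun x => x ^+ 2) = s ^+ 2.
Proof.
have H l : 0 < l -> 0 <= (l - 1) * (2 * l ^+ 2 * s ^+ 2 - (1 + l) * E (fun x => x ^+ 2)).
  move=> l0.
  have : l^-1 + l^-1 * ((1 - l ^- 2) / (s ^+ 2 *+ 2)) * E (fun x => x ^+ 2) <= 1.
    apply: (@lin_bound (fun x => x ^+ 2) 0 (l * s)) => // x.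
    rewrite normal_pdf_scale//.
    set u := (1 - l ^- 2) / (s ^+ 2 *+ 2).
    have -> : (1 - l ^- 2) * (x ^+ 2 / (s ^+ 2 *+ 2)) = u * x ^+ 2.
      by rewrite /u; ring.
    have -> : (l^-1 + l^-1 * u * x ^+ 2) * q x = q x / l * (1 + u * x ^+ 2).
      ring.
    rewrite ler_wpM2l ?expR_ge1Dx// divr_ge0 ?normal_pdf_ge0//.
    exact: ltW.
  move: (E _) => e h.
  have k0 : 0 <= 2 * l ^+ 3 * s ^+ 2 by rewrite !mulr_ge0 ?exprn_ge0 ?ltW.
  have := ler_wpM2l k0 h; rewrite -subr_ge0.
  suff -> : 2 * l ^+ 3 * s ^+ 2 * 1 - 2 * l ^+ 3 * s ^+ 2 *
    (l^-1 + l^-1 * ((1 - l ^- 2) / (s ^+ 2 *+ 2)) * e) =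
    (l - 1) * (2 * l ^+ 2 * s ^+ 2 - (1 + l) * e) by [].
  by field; rewrite !gt_eqF.
move: H; set e := E _ => H.
have s2 : 0 < s ^+ 2 by rewrite exprn_gt0.
apply/eqP; rewrite eq_le; apply/andP; split; apply/ler_addgt0Pr => r r0.
- pose t := Num.min 1 (r / (8 * s ^+ 2)).
  have t0 : 0 < t by rewrite lt_min ltr01 divr_gt0// mulr_gt0.
  have t1 : t <= 1 by rewrite ge_min lexx.
  have tr : t * s ^+ 2 <= r / 8.
    have : t <= r / (8 * s ^+ 2) by rewrite ge_min lexx orbT.
    by move=> /(ler_wpM2r (ltW s2)); congr (_ <= _); field; rewrite gt_eqF.
  have := H (1 + t) ltac:(lra).
  have -> : 1 + t - 1 = t by ring.
  rewrite pmulr_rge0// => h.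
  have t2 : t ^+ 2 * s ^+ 2 <= t * s ^+ 2.
    by rewrite ler_wpM2r ?(ltW s2)// expr2 ler_piMl// ltW.
  rewrite leNgt; apply/negP => re.
  have : (2 + t) * (s ^+ 2 + r) < (2 + t) * e by rewrite ltr_pM2l//; lra.
  nra.
- pose t := Num.min (2^-1) (r / (8 * s ^+ 2)).
  have t0 : 0 < t by rewrite lt_min invr_gt0 ltr0n divr_gt0// mulr_gt0.
  have t1 : t <= 2^-1 by rewrite ge_min lexx.
  have tr : t * s ^+ 2 <= r / 8.
    have : t <= r / (8 * s ^+ 2) by rewrite ge_min lexx orbT.
    by move=> /(ler_wpM2r (ltW s2)); congr (_ <= _); field; rewrite gt_eqF.
  have := H (1 - t) ltac:(lra).
  have -> : 1 - t - 1 = - t by ring.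
  rewrite nmulr_rge0 ?oppr_lt0// => h.
  rewrite leNgt; apply/negP => re.
  have : (2 - t) * (e + r) < (2 - t) * s ^+ 2 by rewrite ltr_pM2l//; lra.
  nra.
Qed.

Lemma normal_fourth_moment : E (fun x => x ^+ 4) <= 57 * s ^+ 4.
Proof.
have -> : 57 * s ^+ 4 = \int[mu]_x (57 * s ^+ 4 * normal_pdf 0 (2 * s) x).
  by rewrite RintegralZl ?Eq1 ?mulr1//; exact: integrable_normal_pdf.
apply: le_Rintegral => //.
- by apply: integrable_EFinZl => //; exact: integrable_normal_pdf.
- by move=> x _; exact: normal_pdf_fourth.
Qed.
End normal_moments.

(** * Independence *)

Section adapted.
Context d (Omega : measurableType d) (R : realType).
Variables (G : set (set Omega)).
Hypothesis sG : sigma_algebra setT G.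

Lemma rv_measurableP (Y : Omega -> R) :
  rv_measurable G Y <-> forall B, measurable B -> G (Y @^-1` B).
Proof.
have sGE : <<s G >> = G by exact: sigma_algebra_id.
split=> [mY B mB|YG].
  have := mY measurableT B mB; rewrite setTI.
  by rewrite /measurable/= sGE.
move=> _ B mB; rewrite setTI.
by rewrite /measurable/= sGE; exact: YG.
Qed.

Lemma rv_measurable_measurable (Y : Omega -> R) : G `<=` measurable ->
  rv_measurable G Y -> measurable_fun setT Y.
Proof.
move=> Gm /rv_measurableP YG _ B mB; rewrite setTI; exact/Gm/YG.
Qed.

End adapted.

Lemma rv_measurable_sub d (Omega : measurableType d) (R : realType)
    (G H : set (set Omega)) (Y : Omega -> R) :
  sigma_algebra setT G -> sigma_algebra setT H ->
  G `<=` H -> rv_measurable G Y -> rv_measurable H Y.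
Proof.
by move=> sG sH GH /(rv_measurableP sG) YG; apply/(rv_measurableP sH) => B /YG/GH.
Qed.

Section independence.
Context d (Omega : measurableType d) (R : realType) (P : probability Omega R).

Definition independent_of (G : set (set Omega)) (D : Omega -> R) :=
  forall A B, G A -> measurable B ->
    P (A `&` D @^-1` B) = (P A * P (D @^-1` B))%E.

Variables (G : set (set Omega)) (xi D : Omega -> R).
Hypotheses (sG : sigma_algebra setT G) (Gm : G `<=` measurable).
Hypotheses (xiG : rv_measurable G xi) (mD : measurable_fun setT D).
Hypothesis (GD : independent_of G D).

Let mxi : measurable_fun setT xi := rv_measurable_measurable sG Gm xiG.

(** Independence says that the joint law of xi and D agrees with the product of
their laws on rectangles, hence everywhere; then apply Tonelli. *)
Lemma ge0_expectation_independent (f g : R -> R) :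
  measurable_fun setT f -> measurable_fun setT g ->
  (forall x, 0 <= f x) -> (forall x, 0 <= g x) ->
  (\int[P]_w (f (xi w) * g (D w))%:E =
   (\int[P]_w (f (xi w))%:E) * (\int[P]_w (g (D w))%:E))%E.
Proof.
move=> mf mg f0 g0.
pose X1 : {mfun Omega >-> R} := HB.pack xi (isMeasurableFun.Build _ _ _ _ xi mxi).
pose X2 : {mfun Omega >-> R} := HB.pack D (isMeasurableFun.Build _ _ _ _ D mD).
have mX : measurable_fun setT (fun w => (xi w, D w)) by exact: measurable_fun_pair.
pose X : {mfun Omega >-> (R * R)%type} := HB.pack (fun w => (xi w, D w))
  (isMeasurableFun.Build _ _ _ _ (fun w => (xi w, D w)) mX).
have lawE : forall Z, measurable Z ->
    (distribution P X1 \x distribution P X2)%E Z = distribution P X Z.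
  apply: product_measure_unique => A B mA mB.
  rewrite /distribution /pushforward/= -GD//.
  by have /(rv_measurableP sG) := xiG; apply.
pose h (z : R * R) := (f z.1 * g z.2)%:E.
have mh : measurable_fun setT h.
  apply/measurable_EFinP/measurable_funM.
    by apply: measurableT_comp => //; exact: measurable_fst.
  by apply: measurableT_comp => //; exact: measurable_snd.
have h0 z : (0 <= h z)%E by rewrite lee_fin mulr_ge0.
rewrite [LHS](_ : _ = \int[distribution P X]_z h z)%E; last first.
  by rewrite ge0_integral_distribution.
transitivity (\int[(distribution P X1 \x distribution P X2)%E]_z h z)%E.
  by apply: eq_measure_integral => Z mZ _; exact/esym/lawE.
rewrite fubini_tonelli1// /fubini_F/=.
under eq_integral => x _.
  under eq_integral do rewrite /h/= EFinM.
  rewrite ge0_integralZl//; last 3 first.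
  - exact/measurable_EFinP.
  - by move=> y _; rewrite lee_fin.
  - by rewrite lee_fin.
  over.
rewrite ge0_integralZr//; last 3 first.
- exact/measurable_EFinP.
- by move=> y _; rewrite lee_fin.
- by apply: integral_ge0 => y _; rewrite lee_fin.
congr (_ * _)%E.
- apply: (@ge0_integral_distribution _ _ _ _ _ P X1 (fun x => (f x)%:E)).
    exact/measurable_EFinP.
  by move=> y; rewrite lee_fin.
- apply: (@ge0_integral_distribution _ _ _ _ _ P X2 (fun x => (g x)%:E)).
    exact/measurable_EFinP.
  by move=> y; rewrite lee_fin.
Qed.

(** The nonnegative case is applied to the four products of positive and
negative parts. *)
Lemma expectation_independent :
  P.-integrable setT (EFin \o xi) -> P.-integrable setT (EFin \o D) ->
  P.-integrable setT (EFin \o (fun w => xi w * D w)) /\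
  \int[P]_w (xi w * D w) = (\int[P]_w xi w) * (\int[P]_w D w).
Proof.
move=> ixi iD.
have ixiD : P.-integrable setT (EFin \o (fun w => xi w * D w)).
  apply/integrableP; split; first exact/measurable_EFinP/measurable_funM.
  under eq_integral do rewrite /= normrM.
  rewrite (ge0_expectation_independent (f := Num.norm) (g := Num.norm))//.
  move/integrableP : ixi => [_]; move/integrableP : iD => [_].
  move=> h1 h2; rewrite lte_mul_pinfty//; first exact: integral_ge0.
  by rewrite ge0_fin_numE//; exact: integral_ge0.
split=> //.
pose p (x : R) := Num.max x 0; pose m (x : R) := Num.max (- x) 0.
have pm x : x = p x - m x.
  rewrite /p /m; case: (leP x 0) => x0.
    by rewrite max_l ?oppr_ge0// opprK add0r.
  by rewrite max_r ?subr0// oppr_le0 ltW.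
have p0 x : 0 <= p x by rewrite le_max lexx orbT.
have m0 x : 0 <= m x by rewrite le_max lexx orbT.
have mp : measurable_fun setT p by exact: measurable_maxr.
have mm : measurable_fun setT m by apply: measurable_maxr.
have plen x : `|p x| <= `|x|.
  by rewrite (ger0_norm (p0 x)) /p ge_max ler_norm normr_ge0.
have mlen x : `|m x| <= `|x|.
  by rewrite (ger0_norm (m0 x)) /m ge_max -normrN ler_norm normr_ge0.
have ip (Y : Omega -> R) : measurable_fun setT Y ->
    P.-integrable setT (EFin \o Y) ->
    P.-integrable setT (EFin \o (p \o Y)) /\
    P.-integrable setT (EFin \o (m \o Y)).
  move=> mY iY; have nY := integrable_norm iY; split.
    apply: (integrable_EFin_le _ _ _ nY) => //; last by move=> w _; exact: plen.
    exact: measurableT_comp.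
  apply: (integrable_EFin_le _ _ _ nY) => //; last by move=> w _; exact: mlen.
  exact: measurableT_comp.
have [ip1 im1] := ip _ mxi ixi; have [ip2 im2] := ip _ mD iD.
have key (f g : R -> R) : measurable_fun setT f -> measurable_fun setT g ->
    (forall x, 0 <= f x) -> (forall x, 0 <= g x) ->
    (forall x, `|f x| <= `|x|) -> (forall x, `|g x| <= `|x|) ->
    P.-integrable setT (EFin \o (f \o xi)) ->
    P.-integrable setT (EFin \o (g \o D)) ->
    \int[P]_w (f (xi w) * g (D w)) = \int[P]_w f (xi w) * \int[P]_w g (D w) /\
    P.-integrable setT (EFin \o (fun w => f (xi w) * g (D w))).
  move=> mf mg f0 g0 fl gl fi gi; split.
    rewrite /Rintegral ge0_expectation_independent// fineM//.
      exact: (integrable_fin_num measurableT fi).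
    exact: (integrable_fin_num measurableT gi).
  have := integrable_norm ixiD; apply: integrable_EFin_le => //.
    by apply: measurable_funM; exact: measurableT_comp.
  by move=> w _ /=; rewrite !normrM ler_pM.
have [e1 j1] := key p p mp mp p0 p0 plen plen ip1 ip2.
have [e2 j2] := key p m mp mm p0 m0 plen mlen ip1 im2.
have [e3 j3] := key m p mm mp m0 p0 mlen plen im1 ip2.
have [e4 j4] := key m m mm mm m0 m0 mlen mlen im1 im2.
transitivity (\int[P]_w ((p (xi w) * p (D w) - p (xi w) * m (D w)) -
                       (m (xi w) * p (D w) - m (xi w) * m (D w)))).
  by apply: eq_Rintegral => w _; rewrite {1}(pm (xi w)) {1}(pm (D w)); ring.
have xiE : \int[P]_w xi w = \int[P]_w p (xi w) - \int[P]_w m (xi w).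
  by rewrite -RintegralB//; apply: eq_Rintegral => w _; rewrite -pm.
have DE : \int[P]_w D w = \int[P]_w p (D w) - \int[P]_w m (D w).
  by rewrite -RintegralB//; apply: eq_Rintegral => w _; rewrite -pm.
rewrite RintegralB//; [|exact: integrable_EFinB..].
rewrite !RintegralB// e1 e2 e3 e4 xiE DE; ring.
Qed.

End independence.

(** * Martingale transforms *)

Section markov.
Context d (Omega : measurableType d) (R : realType) (P : probability Omega R).

Lemma measurable_gt_event (Z : Omega -> R) (a : R) : measurable_fun setT Z ->
  measurable [set w | a < Z w].
Proof.
move=> mZ; have := mZ measurableT `]a, +oo[%classic (measurable_itv _).
by rewrite setTI; congr measurable; apply/seteqP; split=> w /=;
  rewrite in_itv/= andbT.
Qed.

Lemma measurable_le_event (Z : Omega -> R) (a : R) : measurable_fun setT Z ->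
  measurable [set w | Z w <= a].
Proof.
move=> mZ; have := mZ measurableT `]-oo, a]%classic (measurable_itv _).
by rewrite setTI; congr measurable; apply/seteqP; split=> w /=; rewrite in_itv.
Qed.

Lemma markov_bound (Z : Omega -> R) (a b : R) : 0 < a ->
  (forall w, 0 <= Z w) -> P.-integrable setT (EFin \o Z) ->
  \int[P]_w Z w <= b -> (P [set w | (a < Z w)%R] <= (b / a)%:E)%E.
Proof.
move=> a0 Z0 iZ Zb.
have mZ : measurable_fun setT Z by exact/measurable_EFinP/(measurable_int P).
have mA := measurable_gt_event a mZ.
rewrite -[X in P X]setIT -integral_indic//.
have -> : (b / a)%:E = (a^-1%:E * b%:E)%E by rewrite -EFinM mulrC.
apply: (@le_trans _ _ (a^-1%:E * \int[P]_w (Z w)%:E))%E; last first.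
  apply: lee_wpmul2l; first by rewrite lee_fin invr_ge0 ltW.
  move: Zb; rewrite -lee_fin /Rintegral fineK//.
  exact: (integrable_fin_num measurableT iZ).
rewrite -ge0_integralZl//.
- apply: ge0_le_integral => //=.
  + exact/measurable_EFinP/measurable_indic.
  + by apply/measurable_EFinP/measurable_funM.
  + move=> w _; rewrite lee_fin indicE; case: (boolP (w \in _)) => /=.
      by move=> /set_mem/= h; rewrite mulrC ler_pdivlMr// mul1r ltW.
    by rewrite mulr_ge0// invr_ge0 ltW.
- exact/measurable_EFinP.
- by move=> w _; rewrite lee_fin.
- by rewrite lee_fin invr_ge0 ltW.
Qed.

Lemma chebyshev_bound (Y : Omega -> R) (a b : R) : 0 < a ->
  measurable_fun setT Y ->
  P.-integrable setT (EFin \o (fun w => Y w ^+ 2)) ->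
  \int[P]_w Y w ^+ 2 <= b -> (P [set w | (a < `|Y w|)%R] <= (b / a ^+ 2)%:E)%E.
Proof.
move=> a0 mY iY Yb.
rewrite (_ : [set w | a < `|Y w|] = [set w | a ^+ 2 < Y w ^+ 2]).
  by apply: markov_bound => //; rewrite ?exprn_gt0// => w; exact: sqr_ge0.
apply/seteqP; split => w /=;
  by rewrite -(real_normK (num_real (Y w))) ltr_pXn2r ?nnegrE// ltW.
Qed.

Lemma expectation_const (b : R) : \int[P]_w (cst b w) = b.
Proof.
rewrite -[RHS]mulr1 -[X in _ * X](congr1 fine (@probability_setT _ _ _ P)).
by rewrite Rintegral_cst.
Qed.

End markov.

Section martingale_transform.
Context d (Omega : measurableType d) (R : realType) (P : probability Omega R).
Implicit Types (FF : nat -> set (set Omega)) (D xi : nat -> Omega -> R).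

(** Martingale differences. Each D_j is independent of the past FF_j, rather
than merely conditionally centered, so its conditional variance v_j is
deterministic. *)
Record innovations FF D (v : nat -> R) : Prop := Innovations {
  innov_sigma : forall j, sigma_algebra setT (FF j) ;
  innov_meas : forall j, FF j `<=` measurable ;
  innov_mono : forall j, FF j `<=` FF j.+1 ;
  innov_adapted : forall j, rv_measurable (FF j.+1) (D j) ;
  innov_indep : forall j, independent_of P (FF j) (D j) ;
  innov_sqr : forall j, P.-integrable setT (EFin \o (fun w => D j w ^+ 2)) ;
  innov_mean : forall j, \int[P]_w D j w = 0 ;
  innov_var : forall j, \int[P]_w D j w ^+ 2 = v j }.

Definition predictable FF xi := forall j,
  rv_measurable (FF j) (xi j) /\ exists M : R, forall w, `|xi j w| <= M.

Definition transform xi D k w := \sum_(i < k) xi i w * D i w.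
Definition bracket xi (v : nat -> R) k w := \sum_(i < k) xi i w ^+ 2 * v i.

Variables (FF : nat -> set (set Omega)) (D : nat -> Omega -> R) (v : nat -> R).
Hypothesis (FD : innovations FF D v).

Let sFF := innov_sigma FD.
Let FFm := innov_meas FD.

Let mFF j (Y : Omega -> R) : rv_measurable (FF j) Y -> measurable_fun setT Y.
Proof. by apply: rv_measurable_measurable. Qed.

Let v0 j : 0 <= v j.
Proof. by rewrite -(innov_var FD) Rintegral_ge0// => w _; exact: sqr_ge0. Qed.

Let FFS j (Y : Omega -> R) : rv_measurable (FF j) Y -> rv_measurable (FF j.+1) Y.
Proof. by apply: rv_measurable_sub => //; exact: (innov_mono FD). Qed.

Let mD j : measurable_fun setT (D j).
Proof. by apply: mFF; exact: (innov_adapted FD). Qed.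

Let le1sqr (x : R) : `|x| <= 1 + x ^+ 2.
Proof. by rewrite -(real_normK (num_real x)); have := sqr_ge0 (`|x| - 1); nra. Qed.

Lemma innov_integrable j : P.-integrable setT (EFin \o D j).
Proof.
apply: (@integrable_EFin_le _ _ _ P setT measurableT _ (fun w => 1 + D j w ^+ 2)) => //.
apply: integrable_EFinD => //; first exact: finite_measure_integrable_cst.
exact: (innov_sqr FD).
Qed.

Section fixed_integrand.
Variable xi : nat -> Omega -> R.
Hypothesis pxi : predictable FF xi.

Let axi j : rv_measurable (FF j) (xi j). Proof. by case: (pxi j). Qed.

Lemma transform_adapted k : rv_measurable (FF k) (transform xi D k).
Proof.
elim: k => [|k ih].
  rewrite /transform /rv_measurable; under eq_fun do rewrite big_ord0.
  exact: measurable_cst.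
rewrite /transform /rv_measurable; under eq_fun do rewrite big_ord_recr/=.
apply: measurable_funD; first exact: (FFS ih).
by apply: measurable_funM; [exact: (FFS (@axi k))|exact: (innov_adapted FD)].
Qed.

Lemma bracket_adapted k : rv_measurable (FF k) (bracket xi v k.+1).
Proof.
suff H j : (j <= k)%N -> rv_measurable (FF k) (xi j).
  rewrite /bracket /rv_measurable; apply: measurable_sum => i.
  apply: measurable_funM => //; apply: measurable_funX; apply: H.
  by rewrite -ltnS.
elim: k => [|k ih]; first by rewrite leqn0 => /eqP ->.
by rewrite leq_eqVlt => /predU1P[->//|]; rewrite ltnS => /ih/FFS.
Qed.

Lemma measurable_transform k : measurable_fun setT (transform xi D k).
Proof. exact: (mFF (@transform_adapted k)). Qed.

Lemma measurable_bracket k : measurable_fun setT (bracket xi v k).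
Proof.
apply: measurable_sum => i; apply: measurable_funM => //.
by apply: measurable_funX; exact: mFF.
Qed.

Let ixi j : P.-integrable setT (EFin \o (fun w => xi j w ^+ 2)).
Proof.
have [_ [M xiM]] := pxi j.
apply: (@integrable_EFin_le _ _ _ P setT measurableT _ (cst (M ^+ 2))).
- by apply: measurable_funX; exact: mFF.
- move=> w _; rewrite /cst ger0_norm ?sqr_ge0//.
  rewrite -(real_normK (num_real (xi j w))) ler_sqr ?nnegrE//.
  exact: le_trans (xiM w).
- exact: finite_measure_integrable_cst.
Qed.

Lemma integrable_bracket k : P.-integrable setT (EFin \o bracket xi v k).
Proof.
apply: integrable_EFin_sum => // i.
under eq_fun do rewrite mulrC.
exact: integrable_EFinZl.
Qed.

(** The cross term of (N_k + xi_k D_k)^2 vanishes since N_k xi_k is measurable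
for the past and D_k is centered and independent of it. *)
Lemma transform_isometry k :
  P.-integrable setT (EFin \o (fun w => transform xi D k w ^+ 2)) /\
  \int[P]_w (fun w => transform xi D k w ^+ 2) w = \int[P]_w bracket xi v k w.
Proof.
elim: k => [|k [iN EN]].
  have -> : (fun w => transform xi D 0 w ^+ 2) = cst 0.
    by apply/funext => w; rewrite /transform big_ord0 expr0n.
  have -> : bracket xi v 0 = cst 0 by apply/funext => w; exact: big_ord0.
  by split=> //; exact: finite_measure_integrable_cst.
have [_ [M xiM]] := pxi k.
have [iNxi iNxiD ENxiD] : [/\ True,
  P.-integrable setT (EFin \o (fun w => transform xi D k w * xi k w * D k w)) &
  \int[P]_w (transform xi D k w * xi k w * D k w) = 0].
  have aNxi : rv_measurable (FF k) (fun w => transform xi D k w * xi k w).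
    by apply: measurable_funM; [exact: transform_adapted|exact: axi].
  have iNxi : P.-integrable setT
      (EFin \o (fun w => transform xi D k w * xi k w)).
    apply: (@integrable_EFin_le _ _ _ P setT measurableT _
      (fun w => M * (1 + transform xi D k w ^+ 2))).
    - exact: mFF aNxi.
    - by move=> w _; rewrite normrM mulrC ler_pM.
    - apply: integrable_EFinZl => //; apply: integrable_EFinD => //.
      exact: finite_measure_integrable_cst.
  have [h1 h2] := expectation_independent (@sFF k) (@FFm k) aNxi (@mD k)
    (innov_indep FD (j := k)) iNxi (@innov_integrable k).
  by split=> //; rewrite h2 (innov_mean FD) mulr0.
have [ixD ExD] : P.-integrable setT (EFin \o (fun w => xi k w ^+ 2 * D k w ^+ 2))
  /\ \int[P]_w (xi k w ^+ 2 * D k w ^+ 2) = \int[P]_w xi k w ^+ 2 * v k.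
  rewrite -(innov_var FD); apply: (@expectation_independent _ _ _ P (FF k)
    (fun w => xi k w ^+ 2) (fun w => D k w ^+ 2)) => //.
  - exact: measurable_funX (@axi k).
  - exact: measurable_funX.
  - move=> A B FA mB.
    have mB' : measurable ((fun x : R => x ^+ 2) @^-1` B).
      have := @exprn_measurable R setT 2 measurableT B mB.
      by rewrite setTI.
    exact: (innov_indep FD FA mB').
  - exact: (innov_sqr FD).
have E w : transform xi D k.+1 w ^+ 2 = transform xi D k w ^+ 2 +
    2 * (transform xi D k w * xi k w * D k w) + xi k w ^+ 2 * D k w ^+ 2.
  by rewrite /transform big_ord_recr/=; ring.
have i1 : P.-integrable setT (EFin \o (fun w => transform xi D k w ^+ 2 +
    2 * (transform xi D k w * xi k w * D k w))).
  by apply: integrable_EFinD => //; exact: integrable_EFinZl.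
split.
  under eq_fun do rewrite E.
  exact: integrable_EFinD.
under eq_Rintegral do rewrite E.
rewrite RintegralD// RintegralD//; last exact: integrable_EFinZl.
rewrite RintegralZl// ENxiD mulr0 addr0 EN ExD.
under [in RHS]eq_Rintegral do rewrite /bracket big_ord_recr/=.
rewrite RintegralD//; first by rewrite RintegralZr.
  exact: integrable_bracket.
under eq_fun do rewrite mulrC.
exact: integrable_EFinZl.
Qed.

End fixed_integrand.

Arguments transform_isometry {xi} _ k.

Lemma predictableM xi (c : nat -> Omega -> R) : predictable FF xi ->
  (forall j, rv_measurable (FF j) (c j)) -> (forall j w, `|c j w| <= 1) ->
  predictable FF (fun j w => xi j w * c j w).
Proof.
move=> pxi ac c1 j; have [axi [M xiM]] := pxi j; split.
  by apply: measurable_funM; [exact: axi|exact: ac].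
exists M => w; rewrite normrM (le_trans _ (xiM w))//.
by rewrite ler_piMr.
Qed.

Lemma rv_measurable_leind j (Y : Omega -> R) (a : R) :
  rv_measurable (FF j) Y -> rv_measurable (FF j) (fun w => (Y w <= a)%R%:R : R).
Proof.
move=> aY; have -> : (fun w => (Y w <= a)%R%:R : R) =
    (fun x : R => \1_(`]-oo, a]%classic) x : R) \o Y.
  by apply/funext => w /=; rewrite indicE mem_setE/= in_itv.
apply: (measurableT_comp _ aY).
exact: measurable_indic.
Qed.

(** Here c is the indicator that a process is still running; it can only run
while the bracket of the original integrand is at most b. *)
Lemma bracket_stopped_le xi (c : nat -> Omega -> R) (b : R) k w : 0 <= b ->
  (forall j, c j w = 0 \/ c j w = 1 /\ bracket xi v j.+1 w <= b) ->
  bracket (fun j w => xi j w * c j w) v k w <= b.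
Proof.
move=> b0 c01; elim: k => [|k ih]; first by rewrite /bracket big_ord0.
have [ck0|[ck1 le_b]] := c01 k.
  by rewrite /bracket big_ord_recr/= ck0 mulr0 expr0n/= mul0r addr0.
apply: le_trans le_b; apply: ler_sum => i _.
by rewrite ler_wpM2r//; case: (c01 i) => [->|[-> _]];
  rewrite ?mulr1// mulr0 expr0n/= sqr_ge0.
Qed.

(** Kolmogorov inequality, localized by the bracket. The integrand is switched
off as soon as the transform exceeds a or the bracket is about to exceed b. On
the event, the stopped transform freezes at a value larger than a, while by the
isometry its second moment is at most b. *)
Lemma transform_maximal xi (n : nat) (a b : R) : predictable FF xi ->
  0 < a -> 0 <= b ->
  let E := [set w | exists j, [/\ (j <= n)%N, a < `|transform xi D j w| &
                               bracket xi v j w <= b]] in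
  measurable E /\ (P E <= (b / a ^+ 2)%:E)%E.
Proof.
move=> pxi a0 b0 E.
have mE : measurable E.
  rewrite (_ : E = \bigcup_(j in `I_n.+1) ([set w | a < `|transform xi D j w|]
    `&` [set w | bracket xi v j w <= b])).
    apply: bigcup_measurable => j _; apply: measurableI.
      by apply: measurable_gt_event; apply: measurableT_comp => //;
        exact: measurable_transform.
    exact/measurable_le_event/measurable_bracket.
  by apply/seteqP; split => w [j]; [move=> [jn h1 h2]; exists j|
    move=> /= jn [h1 h2]; exists j].
split=> //.
pose below i w := `|transform xi D i w| <= a.
pose top j w : R := \prod_(i < j.+1) (below i w)%:R.
pose c j w : R := top j w * (bracket xi v j.+1 w <= b)%R%:R.
have top1 j w : (forall i, (i <= j)%N -> below i w) -> top j w = 1.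
  by move=> h; apply: big1 => i _; rewrite h// -ltnS.
have top0 j w i : (i <= j)%N -> ~~ below i w -> top j w = 0.
  rewrite -ltnS => ij nb.
  by rewrite /top (bigD1 (Ordinal ij))//= (negbTE nb) mul0r.
have ac j : rv_measurable (FF j) (c j).
  apply: measurable_funM.
    have bi i : rv_measurable (FF i) (fun w => (below i w)%:R : R).
      apply: rv_measurable_leind; apply: measurableT_comp => //.
      exact: transform_adapted.
    elim: j => [|j ih].
      have -> : top 0%N = fun w => (below 0%N w)%:R.
        by apply/funext => w; rewrite /top big_ord1.
      exact: bi.
    have -> : top j.+1 = fun w => top j w * (below j.+1 w)%:R.
      by apply/funext => w; rewrite /top big_ord_recr.
    by apply: measurable_funM; [exact: FFS|exact: bi].
  apply: rv_measurable_leind; exact: bracket_adapted.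
have c01 j w : c j w = 0 \/ c j w = 1 /\ bracket xi v j.+1 w <= b.
  rewrite /c; case: (pselect (forall i, (i <= j)%N -> below i w)) => [/top1 ->|].
    by rewrite mul1r; case: (leP _ b) => _; auto.
  move=> /existsNP[i /not_implyP[ij /negP nb]].
  by rewrite (top0 _ _ _ ij nb) mul0r; auto.
have c1 j w : `|c j w| <= 1 by case: (c01 j w) => [->|[-> _]]; rewrite ?normr0 ?normr1.
pose xi' j w := xi j w * c j w.
have pxi' : predictable FF xi' by exact: predictableM.
have [i2 E2] := transform_isometry pxi' n.
apply: (@le_trans _ _ (P [set w | (a < `|transform xi' D n w|)%R])).
  apply: le_measure; rewrite ?inE//.
    by apply: measurable_gt_event; apply: measurableT_comp => //;
        exact: measurable_transform.
  move=> w /= [j0 [j0n aj0 bj0]].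
  (* The stopped transform freezes at the first exceedance time j. *)
  have : exists j, (a < `|transform xi D j w|) by exists j0.
  move=> /ex_minnP[j aj jmin].
  have jj0 := jmin _ aj0.
  have before i : (i < j)%N -> c i w = 1.
    move=> ij; rewrite /c.
    rewrite top1; last first.
      move=> l li; rewrite /below leNgt; apply/negP => /jmin.
      by rewrite leqNgt (leq_ltn_trans li ij).
    rewrite mul1r (le_trans _ bj0)// /bracket.
    have ij0 : (i.+1 <= j0)%N by exact: leq_trans ij jj0.
    rewrite -(subnKC ij0) big_split_ord/= lerDl sumr_ge0// => l _.
    by rewrite mulr_ge0// sqr_ge0.
  have after i : (j <= i)%N -> c i w = 0.
    by move=> ji; rewrite /c (top0 _ _ _ ji) ?mul0r// /below -ltNge.
  suff -> : transform xi' D n w = transform xi D j w by [].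
  rewrite /transform -(subnKC (leq_trans jj0 j0n)) big_split_ord/=.
  rewrite [X in _ + X]big1 ?addr0; last first.
    by move=> i _; rewrite /xi' after ?leq_addr// mulr0 mul0r.
  by apply: eq_bigr => i _; rewrite /xi' before// mulr1.
apply: chebyshev_bound => //; first exact: measurable_transform.
rewrite E2 -[leRHS](expectation_const P b).
apply: le_Rintegral => //.
- exact: integrable_bracket.
- exact: finite_measure_integrable_cst.
- by move=> w _; exact: bracket_stopped_le.
Qed.

(** The integrand is switched off when the bracket is about to exceed b, which
changes nothing on the event. Each block increment is itself a transform, of
the integrand restricted to the block, so the isometry bounds the expected sum
of squares by the expected bracket. *)
Lemma transform_blocks xi (n m : nat) (beta : nat -> nat) (delta b : R) :
  predictable FF xi -> 0 < delta -> 0 <= b ->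
  (forall i, (beta i <= beta i.+1)%N) -> (beta m <= n)%N ->
  let V w := \sum_(i < m)
    (transform xi D (beta i.+1) w - transform xi D (beta i) w) ^+ 2 in
  let E := [set w | delta < V w /\ bracket xi v n w <= b] in
  measurable E /\ (P E <= (b / delta)%:E)%E.
Proof.
move=> pxi delta0 b0 beta_nd beta_n V E.
have mV (xi' : nat -> Omega -> R) : predictable FF xi' ->
    measurable_fun setT (fun w => \sum_(i < m)
    (transform xi' D (beta i.+1) w - transform xi' D (beta i) w) ^+ 2).
  move=> pxi'; apply: measurable_sum => i; apply: measurable_funX.
  by apply: measurable_funB; exact: measurable_transform.
have mE : measurable E.
  apply: (@measurableI _ _ [set w | delta < V w] [set w | bracket xi v n w <= b]).
    by apply: measurable_gt_event; exact: mV.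
  exact/measurable_le_event/measurable_bracket.
split=> //.
pose c j w : R := (bracket xi v j.+1 w <= b)%R%:R.
have ac j : rv_measurable (FF j) (c j).
  by apply: rv_measurable_leind; exact: bracket_adapted.
have c01 j w : c j w = 0 \/ c j w = 1 /\ bracket xi v j.+1 w <= b.
  by rewrite /c; case: (leP _ b) => _; auto.
have c1 j w : `|c j w| <= 1 by case: (c01 j w) => [->|[-> _]]; rewrite ?normr0 ?normr1.
pose xi' j w := xi j w * c j w.
have pxi' : predictable FF xi' by exact: predictableM.
pose V' w := \sum_(i < m)
    (transform xi' D (beta i.+1) w - transform xi' D (beta i) w) ^+ 2.
have beta_le i j : (i <= j)%N -> (beta i <= beta j)%N.
  by apply: (@homo_leq _ beta leq) => //; exact: leq_trans.
apply: (@le_trans _ _ (P [set w | (delta < V' w)%R])).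
  apply: le_measure; rewrite ?inE//.
    by apply: measurable_gt_event; exact: mV.
  move=> w /= [dV Qb]; rewrite (_ : V' w = V w)//.
  have same k : (k <= n)%N -> transform xi' D k w = transform xi D k w.
    move=> kn; apply: eq_bigr => i _; rewrite /xi' /c.
    suff -> : bracket xi v i.+1 w <= b by rewrite mulr1.
    rewrite (le_trans _ Qb)// /bracket -(subnKC (leq_trans (ltn_ord i) kn)).
    rewrite big_split_ord/= lerDl sumr_ge0// => l _.
    by rewrite mulr_ge0// sqr_ge0.
  apply: eq_bigr => i _; rewrite !same//.
    by rewrite (leq_trans _ beta_n)//; apply/beta_le/ltnW.
  by rewrite (leq_trans _ beta_n)//; apply/beta_le.
pose e (i j : nat) : R := ((beta i <= j) && (j < beta i.+1))%N%:R.
pose xii i j w := xi' j w * e i j.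
have pxii i : predictable FF (xii i).
  apply: (@predictableM xi' (fun j _ => e i j)) => // j.
    exact: measurable_cst.
  by move=> _; rewrite /e; case: (_ && _); rewrite ?normr0 ?normr1.
have block (i : 'I_m) w : transform xi' D (beta i.+1) w - transform xi' D (beta i) w
    = transform (xii i) D n w.
  have bn : (beta i.+1 <= n)%N by rewrite (leq_trans _ beta_n)//; exact/beta_le.
  have telescope : forall k, (beta i <= k)%N -> (k <= beta i.+1)%N ->
     transform xi' D k w - transform xi' D (beta i) w = transform (xii i) D k w.
    move=> k /subnKC <- kb; rewrite /transform !big_split_ord/= addrAC subrr add0r.
    rewrite [X in _ = X + _]big1 ?add0r; last first.
      by move=> l _; rewrite /xii /e leqNgt ltn_ord/= mulr0 mul0r.
    apply: eq_bigr => l _; rewrite /xii /e leq_addr/=.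
    suff -> : (beta i + l < beta i.+1)%N by rewrite mulr1.
    by apply: leq_trans kb; rewrite ltn_add2l.
  rewrite telescope ?beta_nd//.
  rewrite /transform -[in RHS](subnKC bn) big_split_ord/=.
  rewrite [X in _ = _ + X]big1 ?addr0// => l _.
  by rewrite /xii /e ltnNge leq_addr/= andbF mulr0 mul0r.
have V'E w : V' w = \sum_(i < m) transform (xii i) D n w ^+ 2.
  by apply: eq_bigr => i _; rewrite block.
apply: markov_bound => //.
- by move=> w; apply: sumr_ge0 => i _; exact: sqr_ge0.
- rewrite (_ : V' = fun w => \sum_(i < m) transform (xii i) D n w ^+ 2); last exact/funext.
  by apply: integrable_EFin_sum => // i; case: (transform_isometry (pxii i) n).
under eq_Rintegral do rewrite V'E.
rewrite Rintegral_sum//; last first.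
  by move=> i; case: (transform_isometry (pxii i) n).
under eq_bigr => i _ do rewrite (transform_isometry (pxii i) n).2.
rewrite -Rintegral_sum//; last by move=> i; exact: integrable_bracket.
rewrite -[leRHS](expectation_const P b).
apply: le_Rintegral => //.
- by apply: integrable_EFin_sum => // i; exact: integrable_bracket.
- exact: finite_measure_integrable_cst.
move=> w _; apply: le_trans (bracket_stopped_le n b0 (c01 ^~ w)).
rewrite /bracket exchange_big/=; apply: ler_sum => j _.
rewrite -mulr_suml ler_wpM2r//.
rewrite /xii; under eq_bigr do rewrite exprMn.
rewrite -mulr_sumr ler_piMr ?sqr_ge0//.
(* Every index lies in at most one block: the indicators telescope. *)
have -> : \sum_(i < m) e i j ^+ 2 = \sum_(i < m) ((j < beta i.+1)%N%:R - (j < beta i)%N%:R).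
  apply: eq_bigr => i _; rewrite /e leqNgt.
  have := beta_nd i; case: (ltnP j (beta i)) => h1 h2.
    by rewrite (leq_trans h1 h2)/= subrr expr0n.
  by rewrite /= subr0; case: (_ < _)%N; rewrite ?expr1n ?expr0n.
rewrite -(big_mkord xpredT (fun i => ((j < beta i.+1)%N%:R - (j < beta i)%N%:R)))/=.
rewrite telescope_sumr//; case: (_ < _)%N; case: (_ < _)%N => /=; lra.
Qed.

End martingale_transform.

(** * Wiener increments *)

Section wiener.
Context d (Omega : measurableType d) (R : realType) (P : probability Omega R).
Variables (T : R) (F : R -> set (set Omega)) (W : R -> Omega -> R).
Hypotheses (FT : is_filtration T F) (WT : is_wiener P T F W).

Lemma gaussian_expectation (D : Omega -> R) (s : R) : 0 < s ->
  measurable_fun setT D ->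
  (forall B, measurable B -> pushforward P D B = normal_prob 0 s B) ->
  forall f : R -> R, measurable_fun setT f -> (forall x, `|f x| <= 1 + x ^+ 4) ->
  P.-integrable setT (EFin \o (fun w => f (D w))) /\
  \int[P]_w f (D w) = \int[@lebesgue_measure R]_x (f x * normal_pdf 0 s x).
Proof.
move=> s0 mD law f mf fle.
have mD' : measurable_fun setT (D : Omega -> measurableTypeR R) by [].
pose X : {mfun Omega >-> measurableTypeR R} :=
  HB.pack (D : Omega -> measurableTypeR R) (isMeasurableFun.Build _ _ _ _ _ mD').
have [i1 e1] : (distribution P X).-integrable setT (EFin \o f) /\
  (\int[distribution P X]_x (f x)%:E =
   \int[@lebesgue_measure R]_x (f x * normal_pdf 0 s x)%:E)%E.
  apply: (@integral_density _ _ R (@lebesgue_measure R) (distribution P X)) => //; first exact: measurable_normal_pdf.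
  - exact: normal_pdf_ge0.
  - exact: integrable_normal_pdfM.
have i2 : P.-integrable setT (EFin \o (fun w => f (D w))).
  apply/integrableP; split; first exact/measurable_EFinP/measurableT_comp.
  move/integrableP : i1 => [_].
  rewrite ge0_integral_distribution//.
  by apply: measurableT_comp => //; exact/measurable_EFinP.
split=> //; rewrite /Rintegral -e1; congr fine; apply/esym.
apply: (@integral_distribution _ _ _ _ _ P X (EFin \o f)) => //.
exact/measurable_EFinP.
Qed.

Let sF t : 0 <= t <= T -> sigma_algebra setT (F t).
Proof. by case: FT => h _ _; exact: h. Qed.

Let Fm t : 0 <= t <= T -> F t `<=` measurable.
Proof. by case: FT => _ h _; exact: h. Qed.

Let FS s t : 0 <= s -> s <= t -> t <= T -> F s `<=` F t.
Proof. by case: FT => _ _ h; exact: h. Qed.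

Lemma rv_measurable_filtration s t (Y : Omega -> R) :
  0 <= s -> s <= t -> t <= T -> rv_measurable (F s) Y -> rv_measurable (F t) Y.
Proof.
move=> s0 st tT; apply: rv_measurable_sub.
- by apply: sF; rewrite s0 (le_trans st).
- by apply: sF; rewrite tT (le_trans s0).
- exact: FS.
Qed.

Lemma rv_measurable_at t (Y : Omega -> R) : 0 <= t <= T ->
  rv_measurable (F t) Y -> measurable_fun setT Y.
Proof. by move=> tT; apply: rv_measurable_measurable; [exact: sF|exact: Fm]. Qed.

Lemma wiener_incr_adapted s t : 0 <= s -> s <= t -> t <= T ->
  rv_measurable (F t) (fun w => W t w - W s w).
Proof.
move=> s0 st tT; have [_ aW] := wiener_cont_adapted WT.
have t0 := le_trans s0 st.
apply: measurable_funB; first by apply: aW; rewrite t0.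
by apply: (@rv_measurable_filtration s) => //; apply: aW; rewrite s0 (le_trans st).
Qed.

(* The law of an increment is only described for s < t; f 0 = 0 covers s = t,
   which occurs since grids may have repeated points. *)
Let incr_moment s t (f : R -> R) : 0 <= s -> s <= t -> t <= T ->
  measurable_fun setT f -> (forall x, `|f x| <= 1 + x ^+ 4) -> f 0 = 0 ->
  P.-integrable setT (EFin \o (fun w => f (W t w - W s w))) /\
  \int[P]_w f (W t w - W s w) =
  if s == t then 0 else
    \int[@lebesgue_measure R]_x (f x * normal_pdf 0 (Num.sqrt (t - s)) x).
Proof.
move=> s0 st tT mf fle f0.
have [<-|nst] := eqVneq s t.
  have E : (fun w => f (W s w - W s w)) = cst 0.
    by apply/funext => w; rewrite subrr f0.
  rewrite E; split; first exact: finite_measure_integrable_cst.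
  exact: expectation_const.
have lst : s < t by rewrite lt_neqAle nst.
apply: gaussian_expectation => //.
- by rewrite sqrtr_gt0 subr_gt0.
- apply: (@rv_measurable_at t); first by rewrite tT (le_trans s0).
  exact: wiener_incr_adapted.
- exact: (wiener_normal WT).
Qed.

Section increment.
Variables (s t : R).
Hypotheses (s0 : 0 <= s) (st : s <= t) (tT : t <= T).

Lemma wiener_incr_mean : \int[P]_w (W t w - W s w) = 0.
Proof.
have mid : measurable_fun setT (fun x : R => x) by exact: measurable_id.
have [_ ->] := @incr_moment s t id s0 st tT mid (@norm_le_1D4 R) erefl.
case: eqVneq => // nst; apply: normal_mean.
by rewrite sqrtr_gt0 subr_gt0 lt_neqAle nst.
Qed.

Lemma wiener_incr_sqr :
  P.-integrable setT (EFin \o (fun w => (W t w - W s w) ^+ 2)) /\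
  \int[P]_w (W t w - W s w) ^+ 2 = t - s.
Proof.
have [] := @incr_moment s t (fun x => x ^+ 2) s0 st tT.
- exact: exprn_measurable.
- exact: sqr_le_1D4.
- by rewrite expr0n.
move=> -> ->; split=> //.
case: eqVneq => [->|nst]; first by rewrite subrr.
have ts : 0 < t - s by rewrite subr_gt0 lt_neqAle nst.
by rewrite normal_second_moment ?sqrtr_gt0// sqr_sqrtr// ltW.
Qed.

Lemma wiener_incr_fourth :
  P.-integrable setT (EFin \o (fun w => (W t w - W s w) ^+ 4)) /\
  \int[P]_w (W t w - W s w) ^+ 4 <= 57 * (t - s) ^+ 2.
Proof.
have [] := @incr_moment s t (fun x => x ^+ 4) s0 st tT.
- exact: exprn_measurable.
- exact: fourth_le_1D4.
- by rewrite expr0n.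
move=> -> ->; split=> //.
case: eqVneq => [->|nst]; first by rewrite subrr expr0n mulr0.
have ts : 0 < t - s by rewrite subr_gt0 lt_neqAle nst.
rewrite (le_trans (normal_fourth_moment _)) ?sqrtr_gt0//.
by rewrite -[X in _ ^+ X]/(2 * 2)%N exprM sqr_sqrtr// ltW.
Qed.

Lemma wiener_incr_indep : independent_of P (F s) (fun w => W t w - W s w).
Proof.
have [<-|nst] := eqVneq s t; last first.
  have lst : s < t by rewrite lt_neqAle nst.
  by move=> A B FA mB; exact: (wiener_indep WT).
have sT : 0 <= s <= T by rewrite s0 (le_trans st).
move=> A B FA mB.
have [B0|B0] := pselect (B 0).
  rewrite (_ : _ @^-1` B = setT) ?setIT ?probability_setT ?mule1//.
  by apply/seteqP; split=> w //= _; rewrite subrr.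
rewrite (_ : _ @^-1` B = set0) ?setI0 ?measure0 ?mule0//.
by apply/seteqP; split=> w //=; rewrite subrr.
Qed.

End increment.

Variable r : nat -> R.
Hypotheses (r0 : forall j, 0 <= r j) (rS : forall j, r j <= r j.+1).
Hypothesis (rT : forall j, r j <= T).

Lemma wiener_innovations : innovations P (fun j => F (r j))
  (fun j w => W (r j.+1) w - W (r j) w) (fun j => r j.+1 - r j).
Proof.
split=> j.
- by apply: sF; rewrite r0 rT.
- by apply: Fm; rewrite r0 rT.
- exact: FS.
- exact: wiener_incr_adapted.
- exact: wiener_incr_indep.
- by have [] := wiener_incr_sqr (r0 j) (rS j) (rT j.+1).
- exact: wiener_incr_mean.
- by have [] := wiener_incr_sqr (r0 j) (rS j) (rT j.+1).
Qed.

(** The centered squares of the increments are innovations as well; this gives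
the concentration of the quadratic variation. *)
Lemma wiener_sqr_innovations : exists2 v2 : nat -> R,
  innovations P (fun j => F (r j))
    (fun j w => (W (r j.+1) w - W (r j) w) ^+ 2 - (r j.+1 - r j)) v2 &
  forall j, v2 j <= 57 * (r j.+1 - r j) ^+ 2.
Proof.
exists (fun j => \int[P]_w ((W (r j.+1) w - W (r j) w) ^+ 2 - (r j.+1 - r j)) ^+ 2).
  split=> j //.
  - by apply: sF; rewrite r0 rT.
  - by apply: Fm; rewrite r0 rT.
  - exact: FS.
  - apply: measurable_funB => //; apply: measurable_funX.
    exact: wiener_incr_adapted.
  - move=> A B FA mB.
    have mB' : measurable ((fun x : R => x ^+ 2 - (r j.+1 - r j)) @^-1` B).
      rewrite -[X in measurable X]setTI.
      by apply: (@measurable_funB _ _ _ setT (fun x : R => x ^+ 2) (cst (r j.+1 - r j))).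
    exact: (wiener_incr_indep (r0 j) (rS j) (rT j.+1) FA mB').
  - have [i2 _] := wiener_incr_sqr (r0 j) (rS j) (rT j.+1).
    have [i4 _] := wiener_incr_fourth (r0 j) (rS j) (rT j.+1).
    apply: (@integrable_EFin_le _ _ _ P setT measurableT _ (fun w =>
      (W (r j.+1) w - W (r j) w) ^+ 4 + (r j.+1 - r j) ^+ 2)).
    + apply: measurable_funX; apply: measurable_funB => //; apply: measurable_funX.
      apply: (@rv_measurable_at (r j.+1)); first by rewrite r0 rT.
      exact: wiener_incr_adapted.
    + move=> w _; rewrite ger0_norm ?sqr_ge0//.
      have h : 0 <= r j.+1 - r j by rewrite subr_ge0.
      have := sqr_ge0 (W (r j.+1) w - W (r j) w); move: (_ - W _ _) => x.
      by move=> x2; nra.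
    + apply: integrable_EFinD => //; exact: finite_measure_integrable_cst.
  - have [i2 e2] := wiener_incr_sqr (r0 j) (rS j) (rT j.+1).
    rewrite RintegralB//; last exact: finite_measure_integrable_cst.
    by rewrite e2 (expectation_const P (r j.+1 - r j)) subrr.
move=> j.
have [i2 e2] := wiener_incr_sqr (r0 j) (rS j) (rT j.+1).
have [i4 e4] := wiener_incr_fourth (r0 j) (rS j) (rT j.+1).
set h := r j.+1 - r j in e2 e4 *.
have -> : \int[P]_w ((W (r j.+1) w - W (r j) w) ^+ 2 - h) ^+ 2 =
   \int[P]_w ((W (r j.+1) w - W (r j) w) ^+ 4 -
     (2 * h * (W (r j.+1) w - W (r j) w) ^+ 2 - cst (h ^+ 2) w)).
  by apply: eq_Rintegral => w _; rewrite /cst; ring.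
have c : P.-integrable setT (EFin \o cst (h ^+ 2)).
  exact: finite_measure_integrable_cst.
have i2' := integrable_EFinZl measurableT (2 * h) i2.
rewrite RintegralB//; last exact: integrable_EFinB.
rewrite RintegralB// RintegralZl// e2 (expectation_const P).
have := sqr_ge0 h; lra.
Qed.

End wiener.

(** * Simple processes on a grid *)

Section partition.
Context (R : realType).
Variables (T : R) (n : nat) (t : nat -> R).
Hypothesis tP : is_partition T n t.

Lemma partition_le i j : (i <= j)%N -> (j <= n)%N -> t i <= t j.
Proof.
case: tP => _ _ tS /subnKC <-; elim: (j - i)%N => [|k ih] kn.
  by rewrite addn0.
rewrite addnS in kn *; rewrite (le_trans (ih (ltnW kn)))// ltW// tS//.
Qed.

Lemma partition_itv i : (i <= n)%N -> 0 <= t i <= T.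
Proof.
case: (tP) => t0 tn _ ni.
by rewrite -[X in X <= _]t0 -[X in _ <= _ <= X]tn !partition_le.
Qed.

End partition.

Section time_grid.
Context (R : realType).
Implicit Types (T : R) (r : nat -> R) (N : nat).

(** Grids are only required to be nondecreasing, and constant equal to T from
index N on, so that sorting a list of times directly gives one. *)
Record time_grid T N r : Prop := TimeGrid {
  grid0 : r 0%N = 0 ;
  gridS : forall j, r j <= r j.+1 ;
  gridT : forall j, (N <= j)%N -> r j = T }.

Lemma grid_exists T (l : seq R) : 0 <= T -> {in l, forall x, 0 <= x <= T} ->
  exists N r, time_grid T N r /\
    {in l, forall x, exists2 k, (k <= N)%N & r k = x}.
Proof.
move=> T0 lT; pose s := sort <=%R [:: 0, T & l].
have ss : sorted <=%R s by exact/sort_sorted/le_total.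
have s_le x : x \in s -> 0 <= x <= T.
  rewrite mem_sort !inE => /or3P[/eqP ->|/eqP ->|/lT//].
    by rewrite lexx.
  by rewrite lexx andbT.
pose r := nth T s.
have r_le j : 0 <= r j <= T.
  rewrite /r; have [js|sj] := ltnP j (size s); first by rewrite s_le// mem_nth.
  by rewrite nth_default// lexx andbT.
have r_mono i j : (i <= j)%N -> r i <= r j.
  move=> ij; rewrite /r; have [js|sj] := ltnP j (size s).
    by apply: sorted_leq_nth => //; [exact: le_trans|rewrite inE (leq_ltn_trans ij)].
  by rewrite [leRHS]nth_default//; case/andP: (r_le i).
have onr x : x \in s -> exists2 k, (k <= size s)%N & r k = x.
  by move=> xs; exists (index x s); [exact: index_size|rewrite /r nth_index].
exists (size s), r; split; last first.
  by move=> x xl; apply: onr; rewrite mem_sort !inE xl !orbT.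
split=> [|j|j sj]; last by rewrite /r nth_default.
  have [|k _ rk] := onr 0; first by rewrite mem_sort inE eqxx.
  apply/eqP; rewrite eq_le; case/andP: (r_le 0%N) => -> _; rewrite andbT.
  by rewrite -rk r_mono.
exact: r_mono.
Qed.

Section fixed_grid.
Variables (T : R) (N : nat) (r : nat -> R).
Hypothesis rG : time_grid T N r.

Lemma grid_le i j : (i <= j)%N -> r i <= r j.
Proof.
by move=> /subnKC <-; elim: (j - i)%N => [|k ih]; rewrite ?addn0// addnS
  (le_trans ih)// (gridS rG).
Qed.

Lemma grid_ge0 j : 0 <= r j. Proof. by rewrite -(grid0 rG) grid_le. Qed.

Lemma grid_leT j : r j <= T.
Proof.
by rewrite -(gridT rG (leq_addr j N)) grid_le// leq_addl.
Qed.

(** No grid point lies strictly inside a cell: this is the way in which grids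
containing the jump times of a simple process are used. *)
Lemma grid_point_le x j : (exists2 k, (k <= N)%N & r k = x) -> x < r j.+1 -> x <= r j.
Proof.
move=> [k _ <-] kj; apply: grid_le; rewrite -ltnS ltnNge; apply/negP => jk.
by move: kj; rewrite ltNge grid_le.
Qed.

Local Notation mu := (@lebesgue_measure R).

Lemma integral_grid_step (f : R -> R) : measurable_fun setT f ->
  (forall s, 0 <= f s) ->
  (forall j s, r j < s -> s <= r j.+1 -> f s = f (r j.+1)) ->
  forall k, (\int[mu]_(s in `[0%R, r k]) (f s)%:E =
    (\sum_(j < k) f (r j.+1) * (r j.+1 - r j))%:E)%E.
Proof.
move=> mf f0 fc; elim=> [|k ih].
  by rewrite big_ord0 (grid0 rG) set_itv1 integral_set1.
have -> : `[0, r k.+1]%classic = `[0, r k]%classic `|` `]r k, r k.+1]%classic :> set R.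
  by rewrite -itv_bndbnd_setU ?bnd_simp// ?grid_ge0// grid_le.
rewrite ge0_integral_setU//=; last 3 first.
- by apply: measurable_funTS; exact/measurable_EFinP.
- by move=> s _; rewrite lee_fin.
- apply/disj_setPLR => s /=; rewrite !in_itv/= => /andP[_ sk].
  by rewrite ltNge sk.
rewrite ih big_ord_recr/= EFinD; congr (_ + _)%E.
rewrite (eq_integral (cst (f (r k.+1))%:E)); last first.
  by move=> s /set_mem/=; rewrite in_itv/= => /andP[h1 h2]; rewrite (fc k).
rewrite integral_cst//= lebesgue_measure_itv/= lte_fin.
case: ltP => h; first by rewrite -EFinD -EFinM.
have -> : r k.+1 = r k by apply/eqP; rewrite eq_le h grid_le.
by rewrite subrr mulr0 mule0.
Qed.

End fixed_grid.
End time_grid.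

Section simple_process_on_grid.
Context d (Omega : measurableType d) (R : realType) (P : probability Omega R).
Variables (T : R) (F : R -> set (set Omega)) (W : R -> Omega -> R).
Hypotheses (FT : is_filtration T F).
Variables (N : nat) (r : nat -> R) (Z : simple_process Omega R).
Hypotheses (rG : time_grid T N r) (ZS : is_simple T F Z).
Hypothesis Zr : forall i, (i <= sp_size Z)%N ->
  exists2 k, (k <= N)%N & r k = sp_time Z i.

Let Zpart := ZS.1.

Let time_min i j : (i <= sp_size Z)%N ->
  W (Num.min (sp_time Z i) (r j.+1)) = if r j.+1 <= sp_time Z i then W (r j.+1)
    else W (Num.min (sp_time Z i) (r j)).
Proof.
move=> iZ; case: ifPn => [h|]; first by rewrite min_r.
rewrite -ltNge => h; rewrite min_l ?ltW// min_l//.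
exact: (grid_point_le rG (Zr iZ)).
Qed.

(** Passing from one grid point to the next changes the stopped time
min (sp_time Z i) (r k) only if the cell ends before sp_time Z i, and then by
the whole cell. *)
Lemma simple_integral_transform k w :
  simple_integral W Z (r k) w =
  transform (fun j => simple_value Z (r j.+1))
    (fun j w => W (r j.+1) w - W (r j) w) k w.
Proof.
elim: k => [|k ih].
  rewrite /transform big_ord0 /simple_integral big1// => i _.
  have /andP[h0 _] := partition_itv Zpart (ltn_ord i).
  have /andP[h1 _] := partition_itv Zpart (ltnW (ltn_ord i)).
  by rewrite (grid0 rG) !min_r// subrr mulr0.
rewrite /transform in ih *; rewrite big_ord_recr/= -ih.
rewrite /simple_integral /simple_value mulr_suml -big_split/=.
apply: eq_bigr => i _; rewrite !time_min ?(ltnW (ltn_ord i))//.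
have ilt : sp_time Z i < sp_time Z i.+1 by case: Zpart => _ _; exact.
have [h1|h1] := leP (r k.+1) (sp_time Z i).
  have h2 : r k.+1 <= sp_time Z i.+1 by rewrite (le_trans h1)// ltW.
  have rk := gridS rG k.
  have h3 := le_trans rk h1; have h4 := le_trans rk h2.
  by rewrite h2 min_r// min_r// !subrr !mulr0 mul0r addr0.
rewrite /=; have [h2|h2] := leP (r k.+1) (sp_time Z i.+1).
  have rk := gridS rG k.
  have h4 := le_trans rk h2.
  have -> : Num.min (sp_time Z i.+1) (r k) = r k by rewrite min_r.
  by rewrite /=; ring.
by rewrite mulr0 mul0r addr0.
Qed.

Lemma simple_value_cell w j s : r j < s -> s <= r j.+1 ->
  simple_value Z s w = simple_value Z (r j.+1) w.
Proof.
move=> js sj; apply: eq_bigr => i _; congr (_ * (nat_of_bool _)%:R).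
have onL := Zr (ltnW (ltn_ord i)); have onR := Zr (ltn_ord i).
congr (_ && _).
  apply/idP/idP => h; first exact: lt_le_trans sj.
  by rewrite (le_lt_trans (grid_point_le rG onL h)).
apply/idP/idP => h; last exact: le_trans h.
rewrite leNgt; apply/negP => /(grid_point_le rG onR).
by rewrite leNgt (lt_le_trans js h).
Qed.

(** On the cell (r j, r (j+1)] the active coefficient was fixed at a time which
is at most r j. *)
Lemma simple_value_predictable :
  predictable (fun j => F (r j)) (fun j => simple_value Z (r j.+1)).
Proof.
move=> j; split.
  rewrite /simple_value; apply: measurable_sum => i.
  have [_ /(_ i (ltn_ord i))[ac _]] := ZS.
  case: (boolP (_ < _ <= _)) => [/andP[h1 _]|_]; last first.
    rewrite (_ : (fun _ => _) = cst 0); first exact: measurable_cst.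
    by apply/funext => w; rewrite mulr0.
  apply: measurable_funM => //.
  have /andP[i0 iT] := partition_itv Zpart (ltnW (ltn_ord i)).
  apply: (rv_measurable_filtration FT i0 _ _ ac).
    exact: (grid_point_le rG (Zr (ltnW (ltn_ord i)))).
  exact: (grid_leT rG).
have /choice[M hM] : forall i : 'I_(sp_size Z), exists M : R,
    forall w, `|sp_coef Z i w| <= M.
  by move=> i; have [_ /(_ i (ltn_ord i))[]] := ZS.
exists (\sum_i M i) => w; rewrite (le_trans (ler_norm_sum _ _ _))//.
apply: ler_sum => i _; rewrite normrM (le_trans _ (hM i w))//.
by rewrite ler_piMr//; case: (_ && _); rewrite ?normr0 ?normr1.
Qed.

Lemma simple_value_measurable_time w :
  measurable_fun setT (fun s => simple_value Z s w).
Proof.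
apply: measurable_sum => i; apply: measurable_funM => //.
rewrite (_ : (fun _ => _) = \1_(`]sp_time Z i, sp_time Z i.+1]%classic)).
  exact: measurable_indic.
by apply/funext => s; rewrite indicE mem_setE in_itv.
Qed.

End simple_process_on_grid.

(** * Continuous processes and measurability *)

Section continuous_paths.
Context (R : realType).
Implicit Types (T : R) (f : R -> R).

Lemma within_continuousP T f : {within `[0, T], continuous f} <->
  forall x, 0 <= x <= T -> forall e, 0 < e -> exists2 delta, 0 < delta &
    forall y, 0 <= y <= T -> `|x - y| < delta -> `|f x - f y| < e.
Proof.
split.
  move=> /subspace_continuousP cf x xT e e0.
  have /cvgrPdist_lt/(_ e e0) : f @ within `[0, T] (nbhs x) --> f x.
    by apply: cf; rewrite /= in_itv.
  move=> /nbhs_ballP[delta /= delta0 H]; exists delta => // y yT xy.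
  by apply: (H y) => //; rewrite /= in_itv.
move=> H; apply/subspace_continuousP => x; rewrite /= in_itv/= => xT.
apply/cvgrPdist_lt => e /(H x xT)[delta delta0 {}H].
apply/nbhs_ballP; exists delta => //= y xy; rewrite in_itv/= => yT.
exact: H.
Qed.

Lemma within_continuous_sub T a b f : 0 <= a -> b <= T ->
  {within `[0, T], continuous f} -> {within `[a, b], continuous f}.
Proof.
move=> a0 bT; apply: continuous_subspaceW => x /=; rewrite !in_itv/= => /andP[ax xb].
by rewrite (le_trans a0)//= (le_trans xb).
Qed.

Lemma within_continuous_bounded T f : 0 <= T -> {within `[0, T], continuous f} ->
  exists2 M, 0 <= M & forall x, 0 <= x <= T -> `|f x| <= M.
Proof.
move=> T0 cf.
have cnf : {within `[0, T], continuous (fun x => `|f x|)}.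
  move/within_continuousP : cf => cf; apply/within_continuousP => x xT e /(cf x xT)[delta d0 h].
  exists delta => // y yT /(h y yT); apply: le_lt_trans.
  exact: ler_dist_dist.
have [c cT cmax] := EVT_max T0 cnf.
by exists `|f c| => // x xT; apply: cmax; rewrite in_itv.
Qed.

Lemma dense_sequence T : 0 < T -> exists u : nat -> R,
  (forall n, 0 <= u n <= T) /\
  (forall a b, 0 <= a -> a < b -> b <= T -> exists n, a < u n < b).
Proof.
move=> T0.
pose clamp (x : R) := if 0 <= x <= T then x else 0.
exists (fun n => clamp (ratr (odflt 0 (unpickle n)))); split.
  by move=> n; rewrite /clamp; case: ifP => // _; rewrite lexx ltW.
move=> a b a0 ab bT; have [q] := rat_in_itvoo ab.
rewrite in_itv/= => /andP[aq qb]; exists (pickle q); rewrite pickleK/=.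
by rewrite /clamp (le_trans a0 (ltW aq))/= (ltW (lt_le_trans qb bT)) aq.
Qed.

Lemma dense_sequence_near T (u : nat -> R) : 0 < T ->
  (forall a b, 0 <= a -> a < b -> b <= T -> exists n, a < u n < b) ->
  forall t e, 0 <= t <= T -> 0 < e -> exists n, `|u n - t| < e.
Proof.
move=> T0 ud t e /andP[t0 tT] e0; have [ltT|Tt] := ltP t T.
  have [||k /andP[k1 k2]] := ud t (Num.min T (t + e)) t0.
  - by rewrite lt_min ltT ltrDl.
  - by rewrite ge_min lexx.
  exists k; move: k2; rewrite lt_min => /andP[_ k2].
  by rewrite ltr_norml; apply/andP; split; lra.
have -> : t = T by apply/eqP; rewrite eq_le tT.
have [||k /andP[k1 k2]] := ud (Num.max 0 (T - e)) T _ _ (lexx T).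
- by rewrite le_max lexx.
- by rewrite gt_max T0/= ltrBlDr ltrDl.
exists k; move: k1; rewrite gt_max => /andP[_ k1].
by rewrite ltr_norml; apply/andP; split; lra.
Qed.

(** Extends processes from [0, T] to the whole line. *)
Definition clamp T (s : R) := Num.max 0 (Num.min s T).

Lemma clamp_itv T s : 0 <= T -> 0 <= clamp T s <= T.
Proof. by move=> T0; rewrite /clamp le_max lexx/= ge_max T0 ge_min lexx orbT. Qed.

Lemma clamp_id T s : 0 <= s <= T -> clamp T s = s.
Proof. by move=> /andP[s0 sT]; rewrite /clamp min_l// max_r. Qed.

Lemma measurable_clamp T : measurable_fun setT (clamp T).
Proof. by apply: measurable_maxr => //; apply: measurable_minr. Qed.

End continuous_paths.

Section continuous_processes.
Context d (Omega : measurableType d) (R : realType).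
Variables (T : R) (H : R -> Omega -> R).
Hypothesis T0 : 0 < T.
Hypothesis cH : forall w, {within `[0, T], continuous (fun t => H t w)}.
Hypothesis mH : forall t, 0 <= t <= T -> measurable_fun setT (H t).

(** The process is the pointwise limit of the processes obtained by replacing
the time s by the first point of a dense sequence at distance less than
1 / (n + 1) from s; these take countably many times, hence are measurable. *)
Lemma continuous_process_measurable :
  measurable_fun setT (fun z : Omega * measurableTypeR R => H (clamp T z.2) z.1).
Proof.
have [u [uT ud]] := dense_sequence T0.
pose near_ n k (s : R) := `|u k - clamp T s| < n.+1%:R^-1.
have near_ex n s : exists k, near_ n k s.
  by apply: (dense_sequence_near T0 ud (clamp_itv s (ltW T0))); rewrite invr_gt0.
pose idx n s := ex_minn (near_ex n s).
have idxP n s : near_ n (idx n s) s by rewrite /idx; case: ex_minnP.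
have m_near n k : measurable [set s : measurableTypeR R | near_ n k s].
  have mf : measurable_fun setT (fun s : measurableTypeR R => - `|u k - clamp T s|).
    apply: measurableT_comp => //; apply: measurableT_comp => //.
    by apply: measurable_funB => //; exact: measurable_clamp.
  have := measurable_gt_event (- n.+1%:R^-1) mf.
  by congr measurable; apply/seteqP; split => s /=; rewrite ltrN2.
have idxE n k : [set s | idx n s = k] =
    [set s | near_ n k s] `\` \bigcup_(l in `I_k) [set s | near_ n l s].
  apply/seteqP; split => s /=.
    move=> <-; split => // -[l /= lk nl]; move: lk.
    by rewrite /idx; case: ex_minnP => m _ /(_ _ nl); rewrite ltnNge => ->.
  move=> [nk notl]; rewrite /idx; case: ex_minnP => m nm mmin.
  apply/eqP; rewrite eqn_leq mmin//= leqNgt; apply/negP => mk.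
  by apply: notl; exists m.
have m_idx n k : measurable [set s : measurableTypeR R | idx n s = k].
  by rewrite idxE; apply: measurableD => //; apply: bigcup_measurable => l _.
apply: (@measurable_fun_cvg _ _ _ _ (fun n (z : Omega * measurableTypeR R) => H (u (idx n z.2)) z.1)).
  move=> n _ B mB; rewrite setTI.
  have -> : (fun z : Omega * measurableTypeR R => H (u (idx n z.2)) z.1) @^-1` B =
      \bigcup_k ((H (u k) @^-1` B) `*` [set s | idx n s = k]).
    apply/seteqP; split => [[w s]/= h|[w s]/= [k _ []/= h nk]]; last by rewrite nk.
    by exists (idx n s).
  apply: bigcup_measurable => k _; apply: measurableX => //.
  by have := mH (uT k) measurableT mB; rewrite setTI.
move=> [w s] _ /=; apply/cvgrPdist_lt => e e0.
have [delta delta0 h] := (within_continuousP _ _).1 (@cH w) _ (clamp_itv s (ltW T0)) _ e0.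
near=> n; apply: h => //; rewrite distrC (lt_trans (idxP n s))//.
by near: n; exact: (near_infty_natSinv_lt (PosNum delta0)).
Unshelve. all: by end_near. Qed.

(** By continuity the supremum may be taken over a dense sequence. *)
Lemma sup_event (delta : R) : let A := [set w |
    delta < `|sup [set `|H t w| | t in `[0, T]]|] in
  measurable A /\ forall w, ~ A w -> forall t, 0 <= t <= T -> `|H t w| <= delta.
Proof.
move=> A.
have hs w : has_sup [set `|H t w| | t in `[0, T]].
  split; first by exists `|H 0 w|; exists 0 => //; rewrite /= in_itv/= lexx ltW.
  have [M _ hM] := within_continuous_bounded (ltW T0) (@cH w).
  by exists M => x [t /=]; rewrite in_itv/= => tT <-; exact: hM.
have le_sup w t : 0 <= t <= T -> `|H t w| <= sup [set `|H t w| | t in `[0, T]].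
  by move=> tT; apply: sup_upper_bound => //; exists t => //; rewrite /= in_itv.
have sup0 w : `|sup [set `|H t w| | t in `[0, T]]| = sup [set `|H t w| | t in `[0, T]].
  by rewrite ger0_norm// (le_trans _ (le_sup w 0 _))// lexx ltW.
split; last first.
  move=> w /negP; rewrite -leNgt sup0 => wA t tT.
  exact: le_trans (le_sup w t tT) wA.
have [u [uT ud]] := dense_sequence T0.
rewrite (_ : A = \bigcup_n [set w | delta < `|H (u n) w|]).
  apply: bigcup_measurable => n _; apply: measurable_gt_event.
  by apply: measurableT_comp => //; exact: mH.
apply/seteqP; split=> w /=; last first.
  by move=> [n _ /=] h; rewrite /A/= sup0 (lt_le_trans h)// le_sup.
rewrite /A/= sup0 => /(sup_gt (hs w).1)[x [t /=]]; rewrite in_itv/= => tT <- dt.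
have e0 : 0 < `|H t w| - delta by rewrite subr_gt0.
have [eta eta0 h] := (within_continuousP _ _).1 (@cH w) _ tT _ e0.
have [n tn] := dense_sequence_near T0 ud tT eta0; rewrite distrC in tn.
exists n => //=; have := h _ (uT n) tn.
have := ler_dist_dist (H t w) (H (u n) w); have := ler_norm (`|H t w| - `|H (u n) w|).
move=> h1 h2 h3; lra.
Qed.

End continuous_processes.

(** * Approximation of stochastic integrals by simple ones *)

Section ito_approximation.
Context d (Omega : measurableType d) (R : realType) (P : probability Omega R).
Variables (T : R) (F : R -> set (set Omega)) (W H I : R -> Omega -> R).
Hypothesis T0 : 0 < T.
Hypotheses (FT : is_filtration T F) (cW : continuous_adapted T F W).
Local Notation mu := (@lebesgue_measure R).

Lemma simple_integral_continuous (Z : simple_process Omega R) w :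
  is_simple T F Z ->
  {within `[0, T], continuous (fun t => simple_integral W Z t w)}.
Proof.
move=> [Zpart _].
have stop_cont b : 0 <= b <= T ->
    {within `[0, T], continuous (fun t => W (Num.min b t) w)}.
  move=> bT; apply/within_continuousP => x xT e e0.
  have minT y : 0 <= y <= T -> 0 <= Num.min b y <= T.
    by move: bT => /andP[b0 bT] /andP[y0 yT]; rewrite le_min b0 y0 ge_min bT.
  have [delta d0 h] := (within_continuousP _ _).1 (cW.1 w) _ (minT _ xT) _ e0.
  exists delta => // y yT xy; apply: h; first exact: minT.
  apply: le_lt_trans xy.
  have [bx|bx] := leP b x; have [By|By] := leP b y;
   rewrite ?subrr ?normr0//; rewrite !ler_norml;
   apply/andP; split; have := ler_norm (x - y); have := ler_norm (y - x); rewrite distrC; lra.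
apply: continuous_big => [|i _ x]; first exact: add_continuous.
apply: cvgM; first exact: cvg_cst.
apply: cvgB; apply: stop_cont; apply: (partition_itv Zpart) => //.
exact: ltnW.
Qed.

Lemma simple_integral_measurable (Z : simple_process Omega R) t :
  is_simple T F Z -> 0 <= t <= T -> measurable_fun setT (simple_integral W Z t).
Proof.
move=> [Zpart ZS] tT; apply: measurable_sum => i.
have mW s : 0 <= s <= T -> measurable_fun setT (W s).
  by move=> sT; apply: (rv_measurable_at FT sT); apply: cW.2.
have minT b : 0 <= b <= T -> 0 <= Num.min b t <= T.
  by move: tT => /andP[t0 tT] /andP[y0 yT]; rewrite le_min t0 y0 ge_min yT.
have iT := partition_itv Zpart (ltnW (ltn_ord i)).
apply: measurable_funM.
  by have [ac _] := ZS i (ltn_ord i); exact: (rv_measurable_at FT iT ac).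
apply: measurable_funB; apply/mW/minT => //.
exact: (partition_itv Zpart (ltn_ord i)).
Qed.

Lemma simple_value_bounded (Z : simple_process Omega R) w :
  exists2 M, 0 <= M & forall s, `|simple_value Z s w| <= M.
Proof.
exists (\sum_(i < sp_size Z) `|sp_coef Z i w|); first exact: sumr_ge0.
move=> s; rewrite (le_trans (ler_norm_sum _ _ _))//.
apply: ler_sum => i _; rewrite normrM.
by rewrite ler_piMr//; case: (_ && _); rewrite ?normr0 ?normr1.
Qed.

(** Joint measurability in time and chance, then Tonelli. *)
Lemma measurable_sqr_distance (Z : simple_process Omega R) :
  is_simple T F Z -> continuous_adapted T F H ->
  measurable_fun setT
    (fun w => \int[mu]_(s in `[0, T]) (simple_value Z s w - H s w) ^+ 2).
Proof.
move=> ZS cH.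
pose f (z : Omega * measurableTypeR R) : \bar R :=
  (((simple_value Z z.2 z.1 - H (clamp T z.2) z.1) ^+ 2 * \1_`[0, T] z.2)%:E).
have mf : measurable_fun setT f.
  apply/measurable_EFinP; apply: measurable_funM; last first.
    apply: (measurableT_comp _ measurable_snd).
    exact: measurable_indic.
  apply: measurable_funX; apply: measurable_funB; last first.
    apply: continuous_process_measurable => //; first exact: cH.1.
    by move=> t tT; apply: (rv_measurable_at FT tT); apply: cH.2.
  apply: measurable_sum => i; apply: measurable_funM.
    apply: (measurableT_comp _ measurable_fst).
    case: ZS => Zpart /(_ i (ltn_ord i))[ac _].
    exact: (rv_measurable_at FT (partition_itv Zpart (ltnW (ltn_ord i))) ac).
  have -> : (fun x : Omega * measurableTypeR R =>
     (sp_time Z i < x.2 <= sp_time Z i.+1)%R%:R : R) =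
     (fun s : measurableTypeR R => \1_(`]sp_time Z i, sp_time Z i.+1]%classic) s : R) \o snd.
    by apply/funext => -[w s]/=; rewrite indicE mem_setE in_itv.
  apply: (measurableT_comp _ measurable_snd); exact: measurable_indic.
have f0 z : (0 <= f z)%E by rewrite lee_fin mulr_ge0// sqr_ge0.
have := @measurable_fun_fubini_tonelli_F _ _ _ _ R mu f mf f0.
move=> h; have {h} := measurableT_comp (@fine_measurable R setT measurableT) h.
congr measurable_fun; apply/funext => w /=.
rewrite /Rintegral /fubini_F [in RHS]integral_mkcond; congr fine.
apply: eq_integral => s _; rewrite /f/= patchE indicE mem_setE in_itv/=.
by case: (boolP (0 <= s <= T)) => sT /=; rewrite ?mulr0// mulr1 clamp_id.
Qed.

Lemma cvg_in_probability_bound (Y : nat -> Omega -> R) (eta kappa : R) :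
  cvg_in_probability P \oo Y (cst 0) -> 0 < eta -> 0 < kappa ->
  \forall k \near \oo, (P [set w | (eta < `|Y k w|)%R] <= kappa%:E)%E.
Proof.
move=> cY eta0 kappa0; have := cY eta eta0.
move=> /fine_cvgP[fin /cvgrPdist_le/(_ kappa kappa0)].
move: fin; apply: filterS2 => k fink /=.
rewrite sub0r normrN /comp => h.
have -> : [set w | eta < `|Y k w|] = [set w | eta < `|Y k w - cst 0 w|].
  by apply/seteqP; split => w /=; rewrite subr0.
move: fink h; case: (P _) => //= r _ h; rewrite lee_fin.
exact: le_trans (ler_norm _) h.
Qed.

(** The convergences in probability defining the integral, read at a single
approximating process: outside of a small event the integral and the integrand
are both close to those of Z. The event is measurable, which is what turns the
limits of the numbers P(...) into a usable bound. *)
Lemma ito_approximation (eta kappa : R) : is_ito_integral P T F W H I ->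
  0 < eta -> 0 < kappa ->
  exists Z : simple_process Omega R, exists B : set Omega,
  [/\ is_simple T F Z, measurable B, (P B <= kappa%:E)%E &
    forall w, ~ B w ->
      (forall t, 0 <= t <= T -> `|simple_integral W Z t w - I t w| <= eta) /\
      \int[mu]_(s in `[0, T]) (simple_value Z s w - H s w) ^+ 2 <= eta].
Proof.
move=> [cH cI [Z [ZS c1 c2]]] eta0 kappa0.
have kappa20 : 0 < kappa / 2 by rewrite divr_gt0.
have [k [h1 h2]] := filter_ex (filterI (cvg_in_probability_bound c1 eta0 kappa20)
  (cvg_in_probability_bound c2 eta0 kappa20)).
pose B1 := [set w | eta <
  `|\int[mu]_(s in `[0, T]) (simple_value (Z k) s w - H s w) ^+ 2|].
pose B2 := [set w | eta <
   `|sup [set `|simple_integral W (Z k) t w - I t w| | t in `[0, T]]|].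
pose Y t w := simple_integral W (Z k) t w - I t w.
have [mB2 B2P] : measurable B2 /\
    forall w, ~ B2 w -> forall t, 0 <= t <= T -> `|Y t w| <= eta.
  apply: sup_event => // [w x|t tT].
    by apply: cvgB; [exact: simple_integral_continuous|exact: cI.1].
  apply: measurable_funB; first exact: simple_integral_measurable.
  by apply: (rv_measurable_at FT tT); apply: cI.2.
have mB1 : measurable B1.
  apply: measurable_gt_event; apply: measurableT_comp => //.
  exact: measurable_sqr_distance.
exists (Z k), (B1 `|` B2); split => //.
- exact: measurableU.
- rewrite (le_trans (measureU2 _ _ _))//.
  have -> : kappa%:E = ((kappa / 2)%:E + (kappa / 2)%:E)%E.
    by rewrite -EFinD -splitr.
  by apply: leeD; [exact: h1|exact: h2].
- move=> w /not_orP[nB1 nB2]; split; first exact: B2P.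
  by move/negP : nB1; rewrite -leNgt; apply: le_trans; exact: ler_norm.
Qed.

End ito_approximation.

(** * Estimates for integrals of simple processes *)

Section interval_integrals.
Context (R : realType).
Local Notation mu := (@lebesgue_measure R).

Lemma bounded_integrable_itv (a b : R) (f : R -> R) :
  measurable_fun `[a, b] f -> (exists M, forall s, a <= s <= b -> `|f s| <= M) ->
  mu.-integrable `[a, b] (EFin \o f).
Proof.
move=> mf [M hM].
apply: (@integrable_EFin_le _ _ _ mu `[a, b] (measurable_itv _) _ (cst M)) => //.
apply/integrableP; split; first exact/measurable_EFinP/measurable_cst.
rewrite (eq_integral (cst `|M|%:E))// integral_cst//= lebesgue_measure_itv/=.
by case: ifPn => _; rewrite ?mule0// -EFinB -EFinM ltry.
Qed.

Lemma continuous_integrable_itv (T a b : R) (f : R -> R) : 0 <= a -> b <= T ->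
  {within `[0, T], continuous f} -> mu.-integrable `[a, b] (EFin \o f).
Proof.
move=> a0 bT cf; apply: continuous_compact_integrable; first exact: segment_compact.
exact: within_continuous_sub bT cf.
Qed.

Lemma Rintegral_subset (A B : set (measurableTypeR R)) (f : R -> R) : measurable A -> measurable B ->
  A `<=` B -> (forall x, 0 <= f x) -> mu.-integrable B (EFin \o f) ->
  \int[mu]_(s in A) f s <= \int[mu]_(s in B) f s.
Proof.
move=> mA mB AB f0 iB; apply: fine_le.
- exact: (integrable_fin_num mA (integrableS mB mA AB iB)).
- exact: (integrable_fin_num mB iB).
apply: ge0_subset_integral => //.
- exact: (measurable_int mu iB).
- by move=> x _; rewrite lee_fin.
Qed.

End interval_integrals.

Section simple_estimates.
Context d (Omega : measurableType d) (R : realType) (P : probability Omega R).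
Variables (T : R) (F : R -> set (set Omega)) (W : R -> Omega -> R).
Hypothesis T0 : 0 < T.
Hypotheses (FT : is_filtration T F) (WT : is_wiener P T F W).
Local Notation mu := (@lebesgue_measure R).
Implicit Types Z G : simple_process Omega R.

Let times Z := [seq sp_time Z i | i <- iota 0 (sp_size Z).+1].

Let times_itv Z : is_simple T F Z -> {in times Z, forall x, 0 <= x <= T}.
Proof.
move=> [Zpart _] x /mapP[i]; rewrite mem_iota add0n ltnS => /andP[_ iZ] ->.
exact: (partition_itv Zpart).
Qed.

Let mem_times Z i : (i <= sp_size Z)%N -> sp_time Z i \in times Z.
Proof. by move=> iZ; apply: map_f; rewrite mem_iota add0n ltnS. Qed.

Lemma simple_bracket (N : nat) (r : nat -> R) (V : R -> Omega -> R) w k :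
  time_grid T N r -> measurable_fun setT (V ^~ w) ->
  (forall j s, r j < s -> s <= r j.+1 -> V s w = V (r j.+1) w) ->
  \int[mu]_(s in `[0, r k]) V s w ^+ 2 =
  bracket (fun j => V (r j.+1)) (fun j => r j.+1 - r j) k w.
Proof.
move=> rG mV cV; rewrite /Rintegral.
rewrite (integral_grid_step rG (f := fun s => V s w ^+ 2))//.
- exact: measurable_funX.
- by move=> s; exact: sqr_ge0.
- by move=> j s h1 h2; rewrite (cV j).
Qed.

Let simple_grid Z (l : seq R) : is_simple T F Z ->
  {in l, forall x, 0 <= x <= T} -> exists N r,
  [/\ time_grid T N r,
      (forall i, (i <= sp_size Z)%N -> exists2 k, (k <= N)%N & r k = sp_time Z i) &
      {in l, forall x, exists2 k, (k <= N)%N & r k = x}].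
Proof.
move=> ZS lT; have [|N [r [rG rl]]] := grid_exists (T := T) (l := times Z ++ l) (ltW T0).
  by move=> x; rewrite mem_cat => /orP[/(times_itv ZS)|/lT].
exists N, r; split=> // [i iZ|x xl]; apply: rl; rewrite mem_cat.
  by rewrite mem_times.
by rewrite xl orbT.
Qed.

Let cW := wiener_cont_adapted WT.

Lemma simple_value_sqr_integrable Z w t :
  mu.-integrable `[0, t] (EFin \o (fun s => simple_value Z s w ^+ 2)).
Proof.
have [M M0 hM] := simple_value_bounded Z w.
apply: bounded_integrable_itv.
  by apply: measurable_funTS; apply: measurable_funX; exact: simple_value_measurable_time.
exists (M ^+ 2) => s _; rewrite ger0_norm ?sqr_ge0//.
by rewrite -(real_normK (num_real (simple_value Z s w))) ler_sqr ?nnegrE.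
Qed.

(** A grid with finitely many additional times gives the bound at these times.
The exceptional events increase with the set of times, and so the bound passes
to a dense sequence, then to all times by continuity. *)
Lemma simple_integral_maximal Z (a b : R) : is_simple T F Z -> 0 < a -> 0 <= b ->
  exists B, [/\ measurable B, (P B <= (b / a ^+ 2)%:E)%E &
    forall w, ~ B w -> forall t, 0 <= t <= T ->
      \int[mu]_(s in `[0, t]) simple_value Z s w ^+ 2 <= b ->
      `|simple_integral W Z t w| <= a].
Proof.
move=> ZS a0 b0; have [u [uT ud]] := dense_sequence T0.
pose Q t w := \int[mu]_(s in `[0, t]) simple_value Z s w ^+ 2.
pose E m := [set w | exists i, [/\ (i < m)%N,
  a < `|simple_integral W Z (u i) w| & Q (u i) w <= b]].
have gridE m : exists N r, exists idx : nat -> nat, [/\ time_grid T N r,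
    (forall i, (i <= sp_size Z)%N -> exists2 k, (k <= N)%N & r k = sp_time Z i) &
    forall i, (i < m)%N -> (idx i <= N)%N /\ r (idx i) = u i].
  have [|N [r [rG rZ ru]]] := @simple_grid Z [seq u i | i <- iota 0 m] ZS.
    by move=> x /mapP[i _ ->].
  have /choice[idx hidx] : forall i, exists k, (i < m)%N -> (k <= N)%N /\ r k = u i.
    move=> i; have [im|_] := ltnP i m; last by exists 0%N.
    by have [|k kN rk] := ru (u i); [apply: map_f; rewrite mem_iota|exists k].
  by exists N, r, idx.
have QE N r w k : time_grid T N r ->
    (forall i, (i <= sp_size Z)%N -> exists2 k, (k <= N)%N & r k = sp_time Z i) ->
    Q (r k) w = bracket (fun j => simple_value Z (r j.+1)) (fun j => r j.+1 - r j) k w.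
  move=> rG rZ; apply: (simple_bracket _ rG).
    exact: simple_value_measurable_time.
  by move=> j s; exact: (simple_value_cell rG).
have innov N r (rG : time_grid T N r) :=
  wiener_innovations FT WT (grid_ge0 rG) (gridS rG) (grid_leT rG).
have mE m : measurable (E m) /\ (P (E m) <= (b / a ^+ 2)%:E)%E.
  have [N [r [idx [rG rZ hidx]]]] := gridE m.
  have pZ := simple_value_predictable FT rG ZS rZ.
  have mQ i : (i < m)%N -> measurable_fun setT (Q (u i)).
    move=> /hidx[_ <-].
    rewrite (_ : Q _ = bracket (fun j => simple_value Z (r j.+1)) (fun j => r j.+1 - r j) (idx i)).
      exact: (measurable_bracket (innov _ _ rG) pZ).
    by apply/funext => w; exact: (QE _ _ _ _ rG rZ).
  have mEm : measurable (E m).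
    rewrite (_ : E m = \bigcup_(i in `I_m) ([set w | a < `|simple_integral W Z (u i) w|]
        `&` [set w | Q (u i) w <= b])).
      apply: bigcup_measurable => i im; apply: measurableI.
        apply: measurable_gt_event; apply: measurableT_comp => //.
        exact: (simple_integral_measurable FT cW ZS).
      exact/measurable_le_event/mQ.
    by apply/seteqP; split=> w [i]; [move=> [im h1 h2]; exists i|
      move=> /= im [h1 h2]; exists i].
  split=> //.
  have [mE' PE'] := transform_maximal (innov _ _ rG) N pZ a0 b0.
  apply: le_trans PE'; apply: le_measure; rewrite ?inE// => w /= [i [im]].
  have [iN <-] := hidx i im.
  rewrite (QE _ _ _ _ rG rZ) (simple_integral_transform W rG ZS rZ) => h1 h2.
  by exists (idx i).
exists (\bigcup_m E m); split.
- by apply: bigcup_measurable => m _; case: (mE m).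
- have ndE : nondecreasing_seq E.
    move=> m1 m2 m12; apply/subsetPset => w [i [im h1 h2]].
    by exists i; split => //; by apply: leq_trans im _; rewrite -leEnat.
  have cvE := nondecreasing_cvg_mu (mu := P) (fun m => (mE m).1)
     (bigcup_measurable (fun m _ => (mE m).1)) ndE.
  rewrite -(cvg_lim _ cvE)//; apply: lime_le.
    by apply/cvg_ex; eexists; exact: cvE.
  by apply: nearW => m; case: (mE m).
move=> w nB t /andP[t0 tT] Qt.
have below n : u n <= t -> `|simple_integral W Z (u n) w| <= a.
  move=> ut; rewrite leNgt; apply/negP => h; apply: nB.
  exists n.+1 => //; exists n; split => //; apply: le_trans Qt.
  apply: Rintegral_subset => //.
  - by move=> s /=; rewrite !in_itv/= => /andP[-> su]; exact: le_trans ut.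
  - by move=> s; exact: sqr_ge0.
  - exact: simple_value_sqr_integrable.
have [->|tn0] := eqVneq t 0.
  have -> : simple_integral W Z 0 w = 0.
    rewrite /simple_integral big1// => i _.
    have /andP[h0 _] := partition_itv ZS.1 (ltn_ord i).
    have /andP[h1 _] := partition_itv ZS.1 (ltnW (ltn_ord i)).
    by rewrite !min_r// subrr mulr0.
  by rewrite normr0 ltW.
have tp : 0 < t by rewrite lt_neqAle eq_sym tn0.
apply/ler_addgt0Pr => e e0.
have cZ := simple_integral_continuous cW (w := w) ZS.
have tI : 0 <= t <= T by rewrite t0.
have [delta d0 h] := (within_continuousP _ _).1 cZ t tI e e0.
have [||n /andP[n1 n2]] := ud (Num.max 0 (t - delta)) t _ _ tT.
- by rewrite le_max lexx.
- by rewrite gt_max tp/= ltrBlDr ltrDl.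
have := h _ (uT n); move: n1; rewrite gt_max => /andP[_ n1].
rewrite ger0_norm; last by rewrite subr_ge0 ltW.
move=> /(_ ltac:(lra)); have := below n (ltW n2).
have := ler_dist_dist (simple_integral W Z t w) (simple_integral W Z (u n) w).
have := ler_norm (`|simple_integral W Z t w| - `|simple_integral W Z (u n) w|).
lra.
Qed.

Lemma predictableB (FF : nat -> set (set Omega)) (xi zeta : nat -> Omega -> R) :
  predictable FF xi -> predictable FF zeta ->
  predictable FF (fun j w => xi j w - zeta j w).
Proof.
move=> pxi pzeta j; have [axi [M1 h1]] := pxi j; have [azeta [M2 h2]] := pzeta j.
split; first by apply: measurable_funB; [exact: axi|exact: azeta].
by exists (M1 + M2) => w; rewrite (le_trans (ler_normB _ _))// lerD.
Qed.

(** The difference of two simple integrals is a single transform on a grid that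
contains the jump times of both and the partition. *)
Lemma simple_integral_blocks Z G (m : nat) (t : nat -> R) (delta eta : R) :
  is_simple T F Z -> is_simple T F G -> is_partition T m t ->
  0 < delta -> 0 <= eta ->
  exists B, [/\ measurable B, (P B <= (eta / delta)%:E)%E &
    forall w, ~ B w ->
      \int[mu]_(s in `[0, T]) (simple_value Z s w - simple_value G s w) ^+ 2 <= eta ->
      \sum_(i < m) ((simple_integral W Z (t i.+1) w - simple_integral W Z (t i) w) -
         (simple_integral W G (t i.+1) w - simple_integral W G (t i) w)) ^+ 2 <= delta].
Proof.
move=> ZS GS tP delta0 eta0.
have [|N [r [rG rZ rl]]] := @simple_grid Z (times G ++ [seq t i | i <- iota 0 m.+1]) ZS.
  move=> x; rewrite mem_cat => /orP[/(times_itv GS)//|/mapP[i]].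
  by rewrite mem_iota add0n ltnS => /andP[_ im] ->; exact: (partition_itv tP).
have rGt i : (i <= sp_size G)%N -> exists2 k, (k <= N)%N & r k = sp_time G i.
  by move=> iG; apply: rl; rewrite mem_cat mem_times.
have /choice[beta0 hbeta] : forall i, exists k, (k <= N)%N /\ r k = t (minn i m).
  move=> i; have [|k kN rk] := rl (t (minn i m)); last by exists k.
  by rewrite mem_cat map_f ?orbT// mem_iota add0n ltnS geq_minr.
have t_lt i : (i < m)%N -> r (beta0 i) < r (beta0 i.+1).
  move=> im; rewrite (hbeta i).2 (hbeta i.+1).2.
  by rewrite (minn_idPl (ltnW im)) (minn_idPl im); case: tP => _ _; exact.
(* Beyond m the block boundaries are frozen, which keeps beta nondecreasing. *)
pose beta i := beta0 (minn i m).
have beta_nd i : (beta i <= beta i.+1)%N.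
  rewrite /beta; have [im|] := boolP (i < m)%N; last first.
    rewrite -leqNgt => mi.
    by rewrite (minn_idPr mi) (minn_idPr (leqW mi)).
  rewrite (minn_idPl (ltnW im)) (minn_idPl im) leqNgt; apply/negP => h.
  by have := t_lt i im; rewrite ltNge (grid_le rG (ltnW h)).
have rbeta i : (i <= m)%N -> r (beta i) = t i.
  by move=> im; rewrite /beta (hbeta _).2 !(minn_idPl im).
pose xi j w := simple_value Z (r j.+1) w - simple_value G (r j.+1) w.
pose D j w := W (r j.+1) w - W (r j) w.
have pxi : predictable (fun j => F (r j)) xi.
  apply: predictableB.
    exact: (simple_value_predictable FT rG ZS rZ).
  exact: (simple_value_predictable FT rG GS rGt).
have innov := wiener_innovations FT WT (grid_ge0 rG) (gridS rG) (grid_leT rG).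
have [mB PB] := transform_blocks innov pxi (n := N) (beta := beta) (m := m)
  delta0 eta0 beta_nd (hbeta _).1.
eexists; split; [exact: mB|exact: PB|] => w nB Qeta.
rewrite leNgt; apply/negP => h; apply: nB; split.
  apply: lt_le_trans h _; rewrite le_eqVlt; apply/orP; left; apply/eqP.
  apply: eq_bigr => i _; congr (_ ^+ 2).
  rewrite -!rbeta// ?(ltnW (ltn_ord i))//.
  rewrite !(simple_integral_transform W rG ZS rZ) !(simple_integral_transform W rG GS rGt).
  have E k : transform xi D k w =
      transform (fun j => simple_value Z (r j.+1)) D k w -
      transform (fun j => simple_value G (r j.+1)) D k w.
    by rewrite /transform -sumrB; apply: eq_bigr => j _; rewrite /xi mulrBl.
  by rewrite -/D !E; ring.
apply: le_trans Qeta; rewrite -(gridT rG (leqnn N)).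
rewrite (simple_bracket (V := fun s w => simple_value Z s w - simple_value G s w) _ rG)//.
- by apply: measurable_funB; exact: simple_value_measurable_time.
- move=> j s h1 h2; congr (_ - _).
    exact: (simple_value_cell rG rZ).
  exact: (simple_value_cell rG rGt).
Qed.

(** Chebyshev inequality for the transform of the constants g_i^2 with respect
to the centered squared increments. *)
Lemma quadratic_variation_bound (n : nat) (t g : nat -> R) (delta : R) :
  is_partition T n t -> 0 < delta ->
  exists B, [/\ measurable B,
    (P B <= (57 * (\sum_(i < n) g i ^+ 4 * (t i.+1 - t i) ^+ 2) / delta ^+ 2)%:E)%E &
    forall w, ~ B w -> `|\sum_(i < n) g i ^+ 2 * (W (t i.+1) w - W (t i) w) ^+ 2 -
       \sum_(i < n) g i ^+ 2 * (t i.+1 - t i)| <= delta].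
Proof.
move=> tP delta0.
pose r j := t (minn j n).
have rE j : (j <= n)%N -> r j = t j by move=> jn; rewrite /r (minn_idPl jn).
have rT j : 0 <= r j <= T by apply: (partition_itv tP); exact: geq_minr.
have [r0 r1] : (forall j, 0 <= r j) /\ (forall j, r j <= T).
  by split=> j; case/andP: (rT j).
have rS j : r j <= r j.+1.
  apply: (partition_le tP); last exact: geq_minr.
  by rewrite leq_min geq_minr andbT (leq_trans (geq_minl _ _)).
have [v2 innov v2le] := wiener_sqr_innovations FT WT r0 rS r1.
pose xi (j : nat) (w : Omega) := g j ^+ 2.
have pxi : predictable (fun j => F (r j)) xi.
  by move=> j; split; [exact: measurable_cst|exists `|g j ^+ 2|].
have [i2 e2] := transform_isometry innov pxi n.
have mY := @measurable_transform _ _ _ _ _ _ _ innov _ pxi n.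
exists [set w | delta < `|transform xi (fun j w =>
   (W (r j.+1) w - W (r j) w) ^+ 2 - (r j.+1 - r j)) n w|]; split.
- by apply: measurable_gt_event; apply: measurableT_comp.
- apply: chebyshev_bound => //; rewrite e2.
  rewrite /bracket (expectation_const P (\sum_(i < n) (g i ^+ 2) ^+ 2 * v2 i)).
  rewrite mulr_sumr; apply: ler_sum => i _.
  rewrite -exprM mulrCA ler_wpM2l ?exprn_even_ge0//.
  by rewrite (le_trans (v2le i))// !rE// ltnW.
move=> w /negP; rewrite -leNgt; apply: le_trans; rewrite le_eqVlt; apply/orP; left.
apply/eqP; congr `|_|; rewrite /transform -sumrB; apply: eq_bigr => i _.
by rewrite /xi !rE// ?(ltnW (ltn_ord i))//; ring.
Qed.

End simple_estimates.

(** * Perturbation of ordinary differential equations *)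

Section deterministic.
Context (R : realType).
Local Notation mu := (@lebesgue_measure R).

Lemma expR_integral (C t : R) : 0 < C -> 0 <= t ->
  C * \int[mu]_(s in `[0, t]) expR (2 * C * s) = (expR (2 * C * t) - 1) / 2.
Proof.
move=> C0; rewrite le_eqVlt => /predU1P[<-|t0].
  by rewrite set_itv1 Rintegral_set1 !mulr0 expR0 subrr mul0r.
pose f s := C * expR (2 * C * s); pose F s := expR (2 * C * s) / 2.
have dF (s : R) : is_derive s 1 F (f s).
  rewrite /F; apply: is_derive_eq.
  by rewrite /f !scaler0 !add0r/= /GRing.scale/=; field.
have cf : continuous f.
  move=> s; apply: cvgM; first exact: cvg_cst.
  apply: continuous_comp; last exact: continuous_expR.
  by apply: cvgM; [exact: cvg_cst|exact: cvg_id].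
have cF : continuous F by move=> s; apply/differentiable_continuous/derivable1_diffP.
have int_exp : mu.-integrable `[0, t] (EFin \o (fun s => expR (2 * C * s))).
  apply: (@continuous_integrable_itv _ t) => //.
  apply: continuous_subspaceT => s.
  apply: continuous_comp; last exact: continuous_expR.
  by apply: cvgM; [exact: cvg_cst|exact: cvg_id].
rewrite -RintegralZl// /Rintegral.
rewrite (@continuous_FTC2 _ f F)//=.
- by rewrite /F mulr0 expR0; ring.
- exact: continuous_subspaceT.
- split.
  + by move=> s _; have [] := dF s.
  + exact/cvg_at_right_filter/cF.
  + exact/cvg_at_left_filter/cF.
- by move=> s _; rewrite derive1E; have [_ ->] := dF s.
Qed.

(** Evaluate the hypothesis where y(s) e^(-2Cs) reaches its maximum m: the
integral term contributes at most m / 2, so m <= 2 A. *)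
Lemma gronwall (T C A : R) (y : R -> R) : 0 < C -> 0 <= T -> 0 <= A ->
  {within `[0, T], continuous y} ->
  (forall t, 0 <= t <= T -> y t <= A + C * \int[mu]_(s in `[0, t]) y s) ->
  forall t, 0 <= t <= T -> y t <= 2 * A * expR (2 * C * T).
Proof.
move=> C0 T0 A0 cy hy.
pose e s := expR (2 * C * s).
have ce : continuous (fun s => expR (- (2 * C * s))).
  move=> s; apply: continuous_comp; last exact: continuous_expR.
  by apply: cvgN; apply: cvgM; [exact: cvg_cst|exact: cvg_id].
have cye : {within `[0, T], continuous (fun s => y s * expR (- (2 * C * s)))}.
  move=> s; apply: cvgM; first exact: cy.
  exact: (continuous_subspaceT ce).
have [c] := EVT_max T0 cye; rewrite in_itv/= => cT cmax.
set m := y c * expR _ in cmax.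
have ee s : e s * expR (- (2 * C * s)) = 1 by rewrite /e expRxMexpNx_1.
have e0 s : 0 < e s := expR_gt0 _.
have ym s : 0 <= s <= T -> y s <= m * e s.
  move=> sT; have := cmax s; rewrite in_itv/= => /(_ sT).
  move=> /(ler_wpM2r (ltW (e0 s))).
  by rewrite -(mulrA (y s)) (mulrC (expR _) (e s)) ee mulr1.
have m2A : m <= 2 * A.
  have [m0|m0] := leP m 0; first by rewrite (le_trans m0)// mulr_ge0.
  have iye : \int[mu]_(s in `[0, c]) y s <= m * \int[mu]_(s in `[0, c]) e s.
    have [c0 cT'] : 0 <= c /\ c <= T by apply/andP.
    have ie : mu.-integrable `[0, c] (EFin \o e).
      apply: (@continuous_integrable_itv _ c) => //.
      apply: continuous_subspaceT => s.
      apply: continuous_comp; last exact: continuous_expR.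
      by apply: cvgM; [exact: cvg_cst|exact: cvg_id].
    rewrite -RintegralZl//; apply: le_Rintegral => //.
    - exact: continuous_integrable_itv cy.
    - exact: integrable_EFinZl.
    - move=> s; rewrite /= in_itv/= => /andP[s0 sc]; apply: ym.
      by rewrite s0 (le_trans sc).
  have c0 : 0 <= c by case/andP: cT.
  have := hy c cT; have := expR_integral C0 c0.
  rewrite -/(e c) => intE yc.
  have {}yc : y c <= A + m * ((e c - 1) / 2).
    rewrite (le_trans yc)// lerD2l -intE mulrCA ler_wpM2l// ltW//.
  have ge1 : 1 <= e c by rewrite /e -[leLHS]expR0 ler_expR mulr_ge0// mulr_ge0// ltW.
  have ye : y c = m * e c.
    by rewrite /m -(mulrA (y c)) (mulrC (expR _) (e c)) ee mulr1.
  rewrite ye in yc; nra.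
move=> t tT; rewrite (le_trans (ym t tT))//.
rewrite (le_trans (ler_wpM2r (ltW (e0 t)) m2A))// ler_wpM2l ?mulr_ge0//.
by rewrite ler_expR ler_wpM2l ?mulr_ge0 ?(ltW C0)//; case/andP: tT.
Qed.

Lemma lipschitz_within_continuous (T C : R) (f x : R -> R) : 0 < C ->
  is_lipschitz C f -> {within `[0, T], continuous x} ->
  {within `[0, T], continuous (fun s => f (x s))}.
Proof.
move=> C0 lf /within_continuousP cx; apply/within_continuousP => t tT e e0.
have [delta d0 h] := cx t tT (e / C) (divr_gt0 e0 C0).
exists delta => // y yT ty; rewrite (le_lt_trans (lf _ _))//.
by rewrite mulrC -ltr_pdivlMr// h.
Qed.

Lemma ode_solution_integral (T x0 C : R) (S x : R -> R) : 0 < C ->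
  is_lipschitz C S -> ode_solution T x0 S x ->
  forall t, 0 <= t <= T -> x t = x0 + \int[mu]_(s in `[0, t]) S (x s).
Proof.
move=> C0 lS [x00 cx dx] t /andP[]; rewrite le_eqVlt => /predU1P[<- _|t0 tT].
  by rewrite set_itv1 Rintegral_set1 addr0.
have cx' := within_continuous_sub (lexx 0) tT cx.
have cS' := within_continuous_sub (lexx 0) tT (lipschitz_within_continuous C0 lS cx).
have [_ xr xl] := (continuous_within_itvP x t0).1 cx'.
rewrite /Rintegral (@continuous_FTC2 _ (S \o x) x 0 t)//=.
- by rewrite x00; ring.
- split => // s; rewrite in_itv/= => /andP[s0 st].
  by have [|] := dx s; first by rewrite s0 (lt_le_trans st).
- move=> s; rewrite in_itv/= => /andP[s0 st]; rewrite derive1E.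
  by have [|_ ->] := dx s; first by rewrite s0 (lt_le_trans st).
Qed.

Lemma integral_bound_itv (T M s t : R) (f : R -> R) : 0 <= s -> s <= t -> t <= T ->
  {within `[0, T], continuous f} -> (forall u, 0 <= u <= T -> `|f u| <= M) ->
  `|\int[mu]_(u in `[0, t]) f u - \int[mu]_(u in `[0, s]) f u| <= M * (t - s).
Proof.
move=> s0 st tT cf fM.
have i0t : mu.-integrable `[0, t] (EFin \o f) by exact: continuous_integrable_itv cf.
rewrite Rintegral_itvB ?bnd_simp//.
have ist : mu.-integrable `]s, t] (EFin \o f).
  apply: (integrableS _ _ _ i0t) => // u /=; rewrite !in_itv/= => /andP[su ->].
  by rewrite (le_trans s0 (ltW su)).
rewrite (le_trans (le_normr_Rintegral _ _))//.
have ic : mu.-integrable `]s, t] (EFin \o cst M).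
  apply: (@integrableS _ _ _ mu `[s, t]) => //.
    by move=> u /=; rewrite !in_itv/= => /andP[/ltW -> ->].
  by apply: bounded_integrable_itv => //; exists `|M|.
apply: (@le_trans _ _ (\int[mu]_(u in `]s, t]) cst M u)).
  apply: le_Rintegral => //; first exact: integrable_norm.
  move=> u /=; rewrite in_itv/= => /andP[su ut]; apply: fM.
  by rewrite (le_trans s0 (ltW su)) (le_trans ut).
rewrite Rintegral_cst//= lebesgue_measure_itv/= lte_fin.
case: ltP => [_|ts] /=; first by [].
by rewrite mulr0 mulr_ge0 ?subr_ge0// (le_trans _ (fM s _))// s0 (le_trans st).
Qed.

Lemma within_continuous_le_left (T t c : R) (f : R -> R) : 0 < t -> t <= T ->
  {within `[0, T], continuous f} -> (forall s, 0 <= s -> s < t -> f s <= c) -> f t <= c.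
Proof.
move=> t0 tT /within_continuousP cf fc; apply/ler_addgt0Pr => e e0.
have tI : 0 <= t <= T by rewrite ltW.
have [delta d0 h] := cf t tI e e0.
pose s := Num.max 0 (t - delta / 2).
have s0 : 0 <= s by rewrite le_max lexx.
have st : s < t by rewrite gt_max t0/= ltrBlDr ltrDl divr_gt0.
have sd : t - delta / 2 <= s by rewrite le_max lexx orbT.
have := h s _ _; rewrite s0 (le_trans (ltW st) tT) => /(_ isT).
rewrite ger0_norm ?subr_ge0 ?(ltW st)// => /(_ ltac:(lra)).
have := fc s s0 st; have := ler_norm (f t - f s); lra.
Qed.

Section perturbation.
Variables (T x0 C eps : R) (S x xS J : R -> R).
Hypotheses (T0 : 0 < T) (C0 : 0 < C) (eps0 : 0 < eps) (lS : is_lipschitz C S).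
Hypotheses (cx : {within `[0, T], continuous x}) (cxS : {within `[0, T], continuous xS}).
Hypothesis cJ : {within `[0, T], continuous J}.
Hypothesis xE : forall t, 0 <= t <= T ->
  x t = x0 + \int[mu]_(s in `[0, t]) S (x s) + eps * J t.
Hypothesis xSE : forall t, 0 <= t <= T ->
  xS t = x0 + \int[mu]_(s in `[0, t]) S (xS s).

Let cdiff : {within `[0, T], continuous (fun s => `|x s - xS s|)}.
Proof.
apply/within_continuousP => t tT e e0.
have /within_continuousP/(_ t tT e e0)[delta d0 h] :
    {within `[0, T], continuous (fun s => x s - xS s)}.
  by move=> u; apply: cvgB; [exact: cx|exact: cxS].
exists delta => // u uT tu; exact: le_lt_trans (ler_dist_dist _ _) (h u uT tu).
Qed.

Lemma perturbation_stability (t a : R) : 0 <= t <= T -> 0 <= a ->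
  (forall s, 0 <= s <= t -> `|J s| <= a) ->
  forall s, 0 <= s <= t -> `|x s - xS s| <= 2 * (eps * a) * expR (2 * C * T).
Proof.
move=> /andP[t0 tT] a0 Ja s st.
have cd := within_continuous_sub (lexx 0) tT cdiff.
apply: (@le_trans _ _ (2 * (eps * a) * expR (2 * C * t))); last first.
  rewrite ler_wpM2l ?mulr_ge0 ?(ltW eps0)// ler_expR ler_wpM2l// mulr_ge0//.
  exact: ltW.
apply: (gronwall C0 t0 (mulr_ge0 (ltW eps0) a0) cd _ st) => u /andP[u0 ut].
have uT : u <= T := le_trans ut tT.
rewrite xE ?u0// xSE ?u0//.
have i1 : mu.-integrable `[0, u] (EFin \o (fun s => S (x s))).
  apply: (@continuous_integrable_itv _ T) => //.
  exact: lipschitz_within_continuous lS cx.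
have i2 : mu.-integrable `[0, u] (EFin \o (fun s => S (xS s))).
  apply: (@continuous_integrable_itv _ T) => //.
  exact: lipschitz_within_continuous lS cxS.
have i3 : mu.-integrable `[0, u] (EFin \o (fun s => `|x s - xS s|)).
  exact: (@continuous_integrable_itv _ T).
have -> : x0 + \int[mu]_(s in `[0, u]) S (x s) + eps * J u -
   (x0 + \int[mu]_(s in `[0, u]) S (xS s)) = eps * J u +
   (\int[mu]_(s in `[0, u]) S (x s) - \int[mu]_(s in `[0, u]) S (xS s)) by ring.
rewrite -RintegralB// (le_trans (ler_normD _ _))// lerD//.
  by rewrite normrM gtr0_norm// ler_wpM2l ?(ltW eps0)// Ja// u0.
rewrite (le_trans (le_normr_Rintegral _ _))//; first exact: integrable_EFinB.
rewrite -RintegralZl//; apply: le_Rintegral => //.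
- by apply: integrable_norm; exact: integrable_EFinB.
- exact: integrable_EFinZl.
Qed.

(** Bounds on the noise J are available only while x has stayed within distance
1 of xS. At the first time tau where the distance reaches 1, the noise has been
bounded so far, and by the stability estimate the distance is less than 1, a
contradiction. *)
Lemma perturbation_bootstrap (a : R) : 0 <= a -> `|J 0| <= a ->
  2 * (eps * a) * expR (2 * C * T) < 1 ->
  (forall t, 0 <= t <= T -> (forall s, 0 <= s <= t -> `|x s - xS s| <= 1) ->
     `|J t| <= a) ->
  forall s, 0 <= s <= T -> `|x s - xS s| <= 2 * (eps * a) * expR (2 * C * T).
Proof.
move=> a0 J0 c1 HJ.
pose B := [set s | 0 <= s <= T /\ 1 <= `|x s - xS s|].
have [[s1 Bs1]|noB] := pselect (B !=set0); last first.
  apply: (@perturbation_stability T a) => //; first by rewrite lexx ltW.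
  move=> s sT; apply: HJ => // u /andP[u0 us].
  rewrite leNgt; apply/negP => /ltW h; apply: noB; exists u; split=> //.
  by case/andP: sT => _ sT; rewrite u0 (le_trans us).
exfalso; pose tau := inf B.
have hasB : has_inf B by split; [exists s1|exists 0 => u [/andP[]]].
have tau0 : 0 <= tau by apply: lb_le_inf; [exists s1|move=> u [/andP[]]].
have tauT : tau <= T.
  by case: (Bs1) => /andP[_ s1T] _; rewrite (le_trans _ s1T)// ge_inf//; case: hasB.
have tauI : 0 <= tau <= T by rewrite tau0.
have below s : 0 <= s -> s < tau -> `|x s - xS s| <= 1.
  move=> s0 st; rewrite leNgt; apply/negP => /ltW h.
  have : tau <= s.
    apply: ge_inf; first by case: hasB.
    by split => //; rewrite s0 (le_trans (ltW st)).
  by rewrite leNgt st.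
have ytau : 1 <= `|x tau - xS tau|.
  rewrite leNgt; apply/negP => y1.
  have e0 : 0 < 1 - `|x tau - xS tau| by rewrite subr_gt0.
  have [delta d0 h] := (within_continuousP _ _).1 cdiff tau tauI _ e0.
  have [s [sT ys] std] := inf_adherent d0 hasB.
  have ts : tau <= s by apply: ge_inf => //; case: hasB.
  have := h s sT; rewrite distrC ger0_norm ?subr_ge0// => /(_ ltac:(lra)).
  rewrite distrC; have := ler_norm (`|x s - xS s| - `|x tau - xS tau|); lra.
have Jlt s : 0 <= s -> s < tau -> `|J s| <= a.
  move=> s0 st; apply: HJ; first by rewrite s0 (le_trans (ltW st)).
  by move=> u /andP[u0 us]; apply: below => //; exact: le_lt_trans st.
have Jtau : `|J tau| <= a.
  move: tau0; rewrite le_eqVlt => /predU1P[<-//|tau0].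
  apply: (@within_continuous_le_left T tau a (fun s => `|J s|)) => //.
  apply/within_continuousP => t tT e e0.
  have [delta d0 h] := (within_continuousP _ _).1 cJ t tT e e0.
  exists delta => // u uT tu; exact: le_lt_trans (ler_dist_dist _ _) (h u uT tu).
have := @perturbation_stability tau a tauI a0 _ tau.
rewrite tau0 lexx => /(_ _ isT) h.
suff : `|x tau - xS tau| < 1 by rewrite ltNge ytau.
apply: le_lt_trans c1; apply: h => s /andP[s0]; rewrite le_eqVlt => /predU1P[->//|].
exact: Jlt.
Qed.

End perturbation.
End deterministic.

(** * Euclidean norms *)

Section l2.
Context (R : realType).

Lemma cauchy_schwarz_sum (n : nat) (u v : 'I_n -> R) :
  \sum_i u i * v i <= Num.sqrt (\sum_i u i ^+ 2) * Num.sqrt (\sum_i v i ^+ 2).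
Proof.
set A := \sum_i u i ^+ 2; set B := \sum_i v i ^+ 2.
have A0 : 0 <= A by apply: sumr_ge0 => i _; exact: sqr_ge0.
have B0 : 0 <= B by apply: sumr_ge0 => i _; exact: sqr_ge0.
set a := Num.sqrt A; set b := Num.sqrt B.
have a2 : a ^+ 2 = A by exact: sqr_sqrtr.
have b2 : b ^+ 2 = B by exact: sqr_sqrtr.
have [ab0|ab0] := ltP 0 (a * b).
  (* This sum equals 2 a^2 b^2 - 2 a b sum_i u_i v_i. *)
  have : 0 <= \sum_i (b * u i - a * v i) ^+ 2.
    by apply: sumr_ge0 => i _; exact: sqr_ge0.
  rewrite (eq_bigr (fun i => b ^+ 2 * u i ^+ 2 + a ^+ 2 * v i ^+ 2
     - 2 * (a * b) * (u i * v i))); last by move=> i _; ring.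
  rewrite sumrB big_split/= -!mulr_sumr -/A -/B -a2 -b2.
  set s := \sum_i _ => h; rewrite -(ler_pM2l ab0); lra.
have a0 : 0 <= a := sqrtr_ge0 _; have b0 : 0 <= b := sqrtr_ge0 _.
have {}ab0 : a * b = 0 by apply/eqP; rewrite eq_le ab0 mulr_ge0.
have zero (w : 'I_n -> R) : \sum_i w i ^+ 2 = 0 -> forall i, w i = 0.
  move=> w0 i; apply/eqP; rewrite -sqrf_eq0; apply/eqP.
  by apply: (psumr_eq0P _ w0) => // j _; exact: sqr_ge0.
move/eqP : (ab0); rewrite mulf_eq0 ab0 => /orP[] /eqP z0.
  by rewrite big1// => i _; rewrite (zero u) ?mul0r// -/A -a2 z0 expr0n.
by rewrite big1// => i _; rewrite (zero v) ?mulr0// -/B -b2 z0 expr0n.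
Qed.

Lemma sqrt_sum_sqr_dist (n : nat) (u v : 'I_n -> R) :
  `|Num.sqrt (\sum_i u i ^+ 2) - Num.sqrt (\sum_i v i ^+ 2)| <=
  Num.sqrt (\sum_i (u i - v i) ^+ 2).
Proof.
rewrite -sqrtr_sqr ler_sqrt; last by apply: sumr_ge0 => i _; exact: sqr_ge0.
rewrite [leRHS](eq_bigr (fun i => u i ^+ 2 + v i ^+ 2 - 2 * (u i * v i)));
  last by move=> i _; ring.
rewrite sumrB big_split/= -mulr_sumr.
have cs := cauchy_schwarz_sum u v.
have hu : Num.sqrt (\sum_i u i ^+ 2) ^+ 2 = \sum_i u i ^+ 2.
  by rewrite sqr_sqrtr// sumr_ge0// => i _; exact: sqr_ge0.
have hv : Num.sqrt (\sum_i v i ^+ 2) ^+ 2 = \sum_i v i ^+ 2.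
  by rewrite sqr_sqrtr// sumr_ge0// => i _; exact: sqr_ge0.
rewrite -{2}hu -{2}hv; nra.
Qed.

Lemma sqrt_dist (p q : R) : 0 <= p -> 0 <= q ->
  `|Num.sqrt p - Num.sqrt q| <= Num.sqrt `|p - q|.
Proof.
wlog pq : p q / q <= p.
  move=> h p0 q0; have [qp|/ltW pq] := leP q p; first exact: h.
  by rewrite distrC (distrC p); exact: h.
move=> p0 q0; rewrite -sqrtr_sqr ler_sqrt// ger0_norm ?subr_ge0//.
rewrite -{2}(sqr_sqrtr p0) -{2}(sqr_sqrtr q0).
have := ler_wsqrtr pq; have := sqrtr_ge0 q.
move: (Num.sqrt p) (Num.sqrt q) => a b; nra.
Qed.

End l2.

(** * Step processes along the observation times *)

(** The value g i on (t i, t (i+1)] makes the value at time 0 equal to 0, so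
comparisons with continuous functions hold on (0, T] only. *)
Section step_process.
Context d (Omega : measurableType d) (R : realType).
Variables (T : R) (n : nat) (t g : nat -> R).
Hypothesis tP : is_partition T n t.
Local Notation mu := (@lebesgue_measure R).

Definition step_process : simple_process Omega R :=
  SimpleProcess n t (fun i _ => g i).

Lemma partition_grid : time_grid T n (fun j => t (minn j n)).
Proof.
case: (tP) => t0 tn tS; split=> [|j|j nj].
- by rewrite min0n.
- apply: (partition_le tP); last exact: geq_minr.
  by rewrite leq_min geq_minr andbT (leq_trans (geq_minl _ _)).
- by rewrite (minn_idPr nj).
Qed.

Let on_grid i : (i <= n)%N -> exists2 k, (k <= n)%N & t (minn k n) = t i.
Proof. by move=> ni; exists i => //; rewrite (minn_idPl ni). Qed.

Lemma step_process_simple (F : R -> set (set Omega)) : is_simple T F step_process.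
Proof.
split=> // i _; split; first exact: measurable_cst.
by exists `|g i|.
Qed.

Lemma step_process_value i s w : (i < n)%N -> t i < s -> s <= t i.+1 ->
  simple_value step_process s w = g i.
Proof.
move=> ni ts st; rewrite /simple_value/= (bigD1 (Ordinal ni))//= ts st mulr1.
rewrite big1 ?addr0// => j ji.
have [ij|] := ltnP i j.
  have : t i.+1 <= t j by rewrite (partition_le tP)// ltnW.
  by move=> h; rewrite ltNge (le_trans st h) mulr0.
rewrite leq_eqVlt => /predU1P[jE|lji].
  by move: ji; rewrite -val_eqE/= jE eqxx.
have h : t j.+1 <= t i by rewrite (partition_le tP)// ltnW.
by rewrite [X in _ && X]leNgt (le_lt_trans h ts) andbF mulr0.
Qed.

Lemma partition_cover s : 0 < s -> s <= T ->
  exists2 i, (i < n)%N & t i < s <= t i.+1.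
Proof.
move=> s0 sT; case: (tP) => t0 tn _.
have ex : exists j, (j <= n)%N && (s <= t j) by exists n; rewrite leqnn tn.
case: (ex_minnP ex) => -[|m] /andP[mn st] mmin.
  by move: s0; rewrite ltNge -t0 st.
exists m => //; rewrite st andbT ltNge; apply/negP => sm.
by have := mmin m; rewrite sm (ltnW mn) ltnn => /(_ isT).
Qed.

Lemma step_process_integral (W : R -> Omega -> R) i w : (i < n)%N ->
  simple_integral W step_process (t i.+1) w - simple_integral W step_process (t i) w =
  g i * (W (t i.+1) w - W (t i) w).
Proof.
move=> ni; have SP := step_process_simple (fun=> setT).
have E k : (k <= n)%N -> t k = t (minn k n) by move=> kn; rewrite (minn_idPl kn).
have IE k : (k <= n)%N -> simple_integral W step_process (t k) w =
    transform (fun j => simple_value step_process (t (minn j.+1 n)))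
      (fun j w => W (t (minn j.+1 n)) w - W (t (minn j n)) w) k w.
  by move=> /E {1}->; exact: (simple_integral_transform W partition_grid SP on_grid).
rewrite !IE// 1?ltnW// /transform big_ord_recr/= addrAC subrr add0r.
rewrite -!E// 1?ltnW//.
by rewrite (step_process_value (i := i))//; case: tP => _ _; exact.
Qed.

Lemma step_process_sqr_integral w :
  \int[mu]_(s in `[0, T]) simple_value step_process s w ^+ 2 =
  \sum_(i < n) g i ^+ 2 * (t i.+1 - t i).
Proof.
have SP := step_process_simple (fun=> setT).
rewrite -(gridT partition_grid (leqnn n)).
rewrite (simple_bracket n partition_grid)//.
- apply: eq_bigr => i _; have ni := ltn_ord i.
  rewrite (minn_idPl ni) (minn_idPl (ltnW ni)) (step_process_value (i := i))//.
  by case: tP => _ _; exact.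
- exact: simple_value_measurable_time.
- by move=> j s; exact: (simple_value_cell (Z := step_process) partition_grid on_grid).
Qed.

End step_process.

Section interval_estimates.
Context (R : realType).
Local Notation mu := (@lebesgue_measure R).

Lemma Rintegral_le_const (t c : R) (f : R -> R) : 0 <= t ->
  mu.-integrable `[0, t] (EFin \o f) -> (forall s, 0 < s -> s <= t -> f s <= c) ->
  \int[mu]_(s in `[0, t]) f s <= c * t.
Proof.
move=> t0 fi fc.
have sub : (`]0, t]%classic : set R) `<=` `[0, t]%classic.
  by move=> s /=; rewrite !in_itv/= => /andP[/ltW -> ->].
have i1 : mu.-integrable `]0, t] (EFin \o f) by exact: integrableS fi.
rewrite -Rintegral_itv_obnd_cbnd//.
have ic : mu.-integrable `]0, t] (EFin \o cst c).
  apply: (@integrableS _ _ _ mu `[0, t]) => //.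
  by apply: bounded_integrable_itv => //; exists `|c|.
apply: (@le_trans _ _ (\int[mu]_(s in `]0, t]) cst c s)).
  apply: le_Rintegral => // s /=; rewrite in_itv/= => /andP[]; exact: fc.
rewrite Rintegral_cst//= lebesgue_measure_itv/= lte_fin.
case: ltP => /= [_|h]; first by rewrite subr0.
by rewrite (_ : t = 0) ?mulr0//; apply/eqP; rewrite eq_le h.
Qed.

Lemma sqr_integral_le (t : R) (f h : R -> R) :
  mu.-integrable `[0, t] (EFin \o (fun s => f s ^+ 2)) ->
  mu.-integrable `[0, t] (EFin \o (fun s => h s ^+ 2)) ->
  mu.-integrable `[0, t] (EFin \o (fun s => (f s + h s) ^+ 2)) ->
  \int[mu]_(s in `[0, t]) (f s + h s) ^+ 2 <=
  2 * \int[mu]_(s in `[0, t]) f s ^+ 2 + 2 * \int[mu]_(s in `[0, t]) h s ^+ 2.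
Proof.
move=> fi hi fhi; rewrite -!RintegralZl// -RintegralD//; last 2 first.
- exact: integrable_EFinZl.
- exact: integrable_EFinZl.
apply: le_Rintegral => //.
- by apply: integrable_EFinD => //; exact: integrable_EFinZl.
- by move=> s _; have := sqr_ge0 (f s - h s); nra.
Qed.

End interval_estimates.

(** * The estimator on a good path *)

(** Here w is a fixed outcome outside of the exceptional events: [NI] and [ZH]
express that Z approximates the stochastic integral I and its integrand, [Na],
[ZGblocks] and [QV] are the conclusions of the three estimates for simple
processes. The bound b is that of int Z^2 on paths that stay within distance 1
of xS. *)
Section good_path.
Context d (Omega : measurableType d) (R : realType).
Variables (T x0 C M eps a eta b : R) (S sigma xS : R -> R).
Variables (W X I : R -> Omega -> R) (F : R -> set (set Omega)).
Variables (Z : simple_process Omega R) (w : Omega).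
Local Notation mu := (@lebesgue_measure R).
Hypotheses (T0 : 0 < T) (C0 : 0 < C) (M0 : 0 <= M) (eps0 : 0 < eps).
Hypotheses (lS : is_lipschitz C S) (lsigma : is_lipschitz C sigma).
Hypothesis cxS : {within `[0, T], continuous xS}.
Hypothesis xSE : forall t, 0 <= t <= T ->
  xS t = x0 + \int[mu]_(s in `[0, t]) S (xS s).
Hypothesis SM : forall t, 0 <= t <= T -> `|S (xS t)| <= M.
Hypothesis sigmaM : forall t, 0 <= t <= T -> `|sigma (xS t)| <= M.
Hypothesis cX : {within `[0, T], continuous (fun t => X t w)}.
Hypothesis cI : {within `[0, T], continuous (fun t => I t w)}.
Hypothesis XE : forall t, 0 <= t <= T ->
  X t w = x0 + \int[mu]_(s in `[0, t]) S (X s w) + eps * I t w.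
Hypotheses (a0 : 0 <= a) (eta0 : 0 <= eta) (eta1 : eta <= 1).
Hypotheses (ZS : is_simple T F Z).
Hypothesis NI : forall t, 0 <= t <= T -> `|simple_integral W Z t w - I t w| <= eta.
Hypothesis ZH :
  \int[mu]_(s in `[0, T]) (simple_value Z s w - sigma (X s w)) ^+ 2 <= eta.
Hypothesis bE : b = 2 * T * (M + C) ^+ 2 + 2.
Hypothesis Na : forall t, 0 <= t <= T ->
  \int[mu]_(s in `[0, t]) simple_value Z s w ^+ 2 <= b ->
  `|simple_integral W Z t w| <= a.
Let L := 2 * (a + 1) * expR (2 * C * T).
Hypothesis L1 : L * eps < 1.

Let csX : {within `[0, T], continuous (fun t => sigma (X t w))}.
Proof. exact: lipschitz_within_continuous lsigma cX. Qed.

Lemma sqr_diff_integrable (V f : R -> R) t : 0 <= t <= T ->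
  measurable_fun setT V -> (exists K, forall s, `|V s| <= K) ->
  {within `[0, T], continuous f} ->
  mu.-integrable `[0, t] (EFin \o (fun s => (V s - f s) ^+ 2)).
Proof.
move=> /andP[t0 tT] mV [K VK] cf; have [K' K'0 fK'] := within_continuous_bounded (ltW T0) cf.
apply: bounded_integrable_itv.
  apply: measurable_funX; apply: measurable_funB; first exact: measurable_funTS.
  have := continuous_integrable_itv (lexx 0) tT cf.
  by move=> /(measurable_int mu)/measurable_EFinP.
exists ((K + K') ^+ 2) => s /andP[s0 st].
rewrite ger0_norm ?sqr_ge0// -(real_normK (num_real (V s - f s))).
have h : `|V s - f s| <= K + K'.
  by rewrite (le_trans (ler_normB _ _))// lerD// fK'// s0 (le_trans st).
by rewrite ler_sqr ?nnegrE// (le_trans _ h).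
Qed.

Let mZ : measurable_fun setT (fun s => simple_value Z s w).
Proof. exact: simple_value_measurable_time. Qed.

Let bZ : exists K, forall s, `|simple_value Z s w| <= K.
Proof. by have [K _ hK] := simple_value_bounded Z w; exists K. Qed.

(** While |X - xS| <= 1 we have |sigma(X)| <= M + C, so int Z^2 is at most
2 T (M + C)^2 + 2 eta <= b, and [Na] bounds the integral. *)
Lemma path_close t : 0 <= t <= T -> `|X t w - xS t| <= L * eps.
Proof.
have near_le (p q : R) : `|q| <= `|p| + `|p - q|.
  by rewrite -{1}(subKr p q) ler_normB.
have LE : 2 * (eps * (a + 1)) * expR (2 * C * T) = L * eps by rewrite /L; ring.
rewrite -LE; apply: (perturbation_bootstrap T0 C0 eps0 lS cX cxS cI XE xSE).
- exact: addr_ge0.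
- have z : 0 <= (0:R) <= T by rewrite lexx ltW.
  have N0 : `|simple_integral W Z 0 w| <= a.
    apply: Na => //; rewrite set_itv1 Rintegral_set1 bE.
    apply: addr_ge0 => //; apply: mulr_ge0; last exact: sqr_ge0.
    by apply: mulr_ge0 => //; exact: ltW.
  apply: (le_trans (near_le (simple_integral W Z 0 w) _)); apply: lerD => //.
  exact: le_trans (NI z) eta1.
- by rewrite LE.
move=> u uT Xu.
have Nu : `|simple_integral W Z u w| <= a.
  apply: Na => //; have [u0 uT'] : 0 <= u /\ u <= T by apply/andP.
  have i1 := sqr_diff_integrable uT mZ bZ csX.
  have i2 : mu.-integrable `[0, u] (EFin \o (fun s => sigma (X s w) ^+ 2)).
    have := @sqr_diff_integrable (cst 0) _ u uT (measurable_cst _) _ csX.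
    have -> : (fun s => (cst 0 s - sigma (X s w)) ^+ 2) = (fun s => sigma (X s w) ^+ 2).
      by apply/funext => s; rewrite /cst sub0r sqrrN.
    by apply; exists 0 => s; rewrite normr0.
  have fE : (fun s => simple_value Z s w ^+ 2) =
     (fun s => ((simple_value Z s w - sigma (X s w)) + sigma (X s w)) ^+ 2).
    by apply/funext => s; rewrite subrK.
  have := simple_value_sqr_integrable Z w u; rewrite fE => i3.
  apply: le_trans (sqr_integral_le i1 i2 i3) _.
  have h1 : \int[mu]_(s in `[0, u]) (simple_value Z s w - sigma (X s w)) ^+ 2 <= eta.
    apply: le_trans ZH; apply: Rintegral_subset => //.
    - by move=> s /=; rewrite !in_itv/= => /andP[-> su]; exact: le_trans uT'.
    - by move=> s; exact: sqr_ge0.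
    - by apply: sqr_diff_integrable => //; rewrite lexx ltW.
  have h2 : \int[mu]_(s in `[0, u]) sigma (X s w) ^+ 2 <= (M + C) ^+ 2 * u.
    apply: Rintegral_le_const => // s s0 su.
    have sT : 0 <= s <= T by rewrite (ltW s0) (le_trans su).
    have : `|sigma (X s w)| <= M + C.
      have -> : sigma (X s w) = sigma (xS s) + (sigma (X s w) - sigma (xS s)) by ring.
      rewrite (le_trans (ler_normD _ _))// lerD ?sigmaM//.
      rewrite (le_trans (lsigma _ _))// ler_piMr ?(ltW C0)// Xu//.
      by rewrite (ltW s0) su.
    move=> h; rewrite -(real_normK (num_real (sigma _))) ler_sqr ?nnegrE//.
    by rewrite (le_trans _ h).
  have h3 : (M + C) ^+ 2 * u <= (M + C) ^+ 2 * T by rewrite ler_wpM2l ?sqr_ge0.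
  have -> : b = 2 * 1 + 2 * ((M + C) ^+ 2 * T) by rewrite bE; ring.
  apply: lerD; rewrite ler_wpM2l//; first exact: le_trans h1 eta1.
  exact: le_trans h2 h3.
apply: (le_trans (near_le (simple_integral W Z u w) _)); apply: lerD => //.
exact: le_trans (NI uT) eta1.
Qed.

Variables (n : nat) (t : nat -> R) (h delta : R).
Hypothesis tP : is_partition T n t.
Hypothesis th : forall i, (i < n)%N -> t i.+1 - t i <= h.
Hypothesis delta0 : 0 < delta.
Let g i := sigma (xS (t i)).
Let G := step_process Omega n t g.
Hypothesis ZGblocks :
  \int[mu]_(s in `[0, T]) (simple_value Z s w - simple_value G s w) ^+ 2 <=
     2 * eta + 2 * (T * (C * (L * eps) + C * (M * h)) ^+ 2) ->
  \sum_(i < n) ((simple_integral W Z (t i.+1) w - simple_integral W Z (t i) w) -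
     (simple_integral W G (t i.+1) w - simple_integral W G (t i) w)) ^+ 2 <= delta ^+ 2 / 36.
Hypothesis QV : `|\sum_(i < n) g i ^+ 2 * (W (t i.+1) w - W (t i) w) ^+ 2 -
       \sum_(i < n) g i ^+ 2 * (t i.+1 - t i)| <= delta ^+ 2 / 8.
Hypothesis small_eta : n%:R * (2 * eta) ^+ 2 <= delta ^+ 2 / 36.
Hypothesis small_drift : (M + C) ^+ 2 * h * T <= eps ^+ 2 * (delta ^+ 2 / 36).
Hypothesis small_riemann : 2 * M * (C * (M * h)) * T <= delta ^+ 2 / 8.

Let n0 : (0 < n)%N.
Proof.
case: (tP) => t0 tn _; case: (n) tn => // tn; move: T0.
by rewrite -tn t0 ltxx.
Qed.

Let h0 : 0 <= h.
Proof.
case: (tP) => _ _ /(_ _ n0) t01; apply: le_trans (th n0).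
by rewrite subr_ge0 ltW.
Qed.

Let tI i : (i <= n)%N -> 0 <= t i <= T.
Proof. exact: (partition_itv tP). Qed.

Let xS_lip s u : 0 <= s -> s <= u -> u <= T -> `|xS u - xS s| <= M * (u - s).
Proof.
move=> s0 su uT; rewrite !xSE ?s0 ?(le_trans su)// ?(le_trans s0)//.
have -> : forall p q : R, x0 + p - (x0 + q) = p - q by move=> p q; ring.
apply: (integral_bound_itv s0 su uT) => //.
exact: lipschitz_within_continuous lS cxS.
Qed.

Lemma step_near s : 0 < s -> s <= T ->
  `|simple_value G s w - sigma (xS s)| <= C * (M * h).
Proof.
move=> s0 sT; have [i ni /andP[ts st]] := partition_cover tP s0 sT.
rewrite (step_process_value (i := i) _ tP)// (le_trans (lsigma _ _))//.
rewrite ler_wpM2l ?(ltW C0)// distrC.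
have /andP[ti0 _] := tI (ltnW ni).
rewrite (le_trans (xS_lip ti0 (ltW ts) sT))// ler_wpM2l//.
by rewrite (le_trans _ (th ni))// lerB.
Qed.

Lemma step_bound s : 0 < s -> s <= T -> `|simple_value G s w| <= M.
Proof.
move=> s0 sT; have [i ni /andP[ts st]] := partition_cover tP s0 sT.
by rewrite (step_process_value (i := i) _ tP)// sigmaM// tI// ltnW.
Qed.

Let mG : measurable_fun setT (fun s => simple_value G s w).
Proof. exact: simple_value_measurable_time. Qed.

Let bG : exists K, forall s, `|simple_value G s w| <= K.
Proof. by have [K _ hK] := simple_value_bounded G w; exists K. Qed.

Let TT : 0 <= T <= T. Proof. by rewrite lexx ltW. Qed.

(** Z is close to sigma(X) in mean square, sigma(X) to sigma(xS) since X is
close to xS, and sigma(xS) to the step process since xS is Lipschitz. *)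
Lemma blocks_small :
  \sum_(i < n) ((simple_integral W Z (t i.+1) w - simple_integral W Z (t i) w) -
     g i * (W (t i.+1) w - W (t i) w)) ^+ 2 <= delta ^+ 2 / 36.
Proof.
rewrite (eq_bigr (fun i : 'I_n => ((simple_integral W Z (t i.+1) w - simple_integral W Z (t i) w) -
     (simple_integral W G (t i.+1) w - simple_integral W G (t i) w)) ^+ 2)); last first.
  by move=> i _; rewrite (step_process_integral g tP).
apply: ZGblocks.
have i1 := sqr_diff_integrable TT mZ bZ csX.
have i2 : mu.-integrable `[0, T]
    (EFin \o (fun s => (sigma (X s w) - simple_value G s w) ^+ 2)).
  have := sqr_diff_integrable TT mG bG csX.
  have -> // : (fun s => (simple_value G s w - sigma (X s w)) ^+ 2) =
     (fun s => (sigma (X s w) - simple_value G s w) ^+ 2).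
  by apply/funext => s; rewrite -sqrrN opprB.
have i3 : mu.-integrable `[0, T] (EFin \o (fun s =>
   (simple_value Z s w - sigma (X s w) + (sigma (X s w) - simple_value G s w)) ^+ 2)).
  have mZG : measurable_fun setT (fun s => simple_value Z s w - simple_value G s w).
    exact: measurable_funB.
  have := @sqr_diff_integrable _ (cst 0) T TT mZG.
  have -> : (fun s => (simple_value Z s w - simple_value G s w - cst 0 s) ^+ 2) =
    (fun s => (simple_value Z s w - sigma (X s w) + (sigma (X s w) - simple_value G s w)) ^+ 2).
    by apply/funext => s; rewrite /cst; congr (_ ^+ 2); ring.
  apply; last by move=> ?; exact: cst_continuous.
  have [K1 h1] := bZ; have [K2 h2] := bG; exists (K1 + K2) => s.
  by rewrite (le_trans (ler_normB _ _))// lerD.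
have -> : (fun s => (simple_value Z s w - simple_value G s w) ^+ 2) =
  (fun s => (simple_value Z s w - sigma (X s w) + (sigma (X s w) - simple_value G s w)) ^+ 2).
  by apply/funext => s; congr (_ ^+ 2); ring.
apply: le_trans (sqr_integral_le i1 i2 i3) _; rewrite lerD ?ler_wpM2l//.
rewrite mulrC; apply: Rintegral_le_const => //; first exact: ltW.
move=> s s0 sT; set rho := C * (L * eps) + C * (M * h).
have sI : 0 <= s <= T by rewrite ltW.
have hs : `|sigma (X s w) - simple_value G s w| <= rho.
  have -> : sigma (X s w) - simple_value G s w =
    (sigma (X s w) - sigma (xS s)) - (simple_value G s w - sigma (xS s)) by ring.
  rewrite (le_trans (ler_normB _ _))// lerD ?step_near//.
  by rewrite (le_trans (lsigma _ _))// ler_wpM2l ?(ltW C0)// path_close.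
rewrite -(real_normK (num_real (sigma _ - _))) ler_sqr ?nnegrE//.
by rewrite (le_trans _ hs).
Qed.

Lemma riemann_small : `|\sum_(i < n) g i ^+ 2 * (t i.+1 - t i) -
   \int[mu]_(s in `[0, T]) sigma (xS s) ^+ 2| <= delta ^+ 2 / 8.
Proof.
have cs : {within `[0, T], continuous (fun s => sigma (xS s))}.
  exact: lipschitz_within_continuous lsigma cxS.
have c0 : {within `[0, T], continuous (cst (0 : R))} by move=> ?; exact: cst_continuous.
have i1 : mu.-integrable `[0, T] (EFin \o (fun s => simple_value G s w ^+ 2)).
  exact: simple_value_sqr_integrable.
have i2 : mu.-integrable `[0, T] (EFin \o (fun s => sigma (xS s) ^+ 2)).
  have := @sqr_diff_integrable (cst 0) _ T TT (measurable_cst _) _ cs.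
  have -> : (fun s => (cst 0 s - sigma (xS s)) ^+ 2) = (fun s => sigma (xS s) ^+ 2).
    by apply/funext => s; rewrite /cst sub0r sqrrN.
  by apply; exists 0 => s; rewrite normr0.
rewrite -(step_process_sqr_integral g tP w) -RintegralB//.
have i3 : mu.-integrable `[0, T]
    (EFin \o (fun s => simple_value G s w ^+ 2 - sigma (xS s) ^+ 2)).
  exact: integrable_EFinB.
apply: le_trans (le_normr_Rintegral _ i3) _ => //.
apply: le_trans small_riemann; apply: Rintegral_le_const => //; first exact: ltW.
  exact: integrable_norm.
move=> s s0 sT; rewrite subr_sqr normrM mulrC ler_pM//.
  have sI : 0 <= s <= T by rewrite ltW.
  rewrite (le_trans (ler_normD _ _))//.
  by have := step_bound s0 sT; have := sigmaM sI; lra.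
exact: step_near.
Qed.

(** The vector V - U splits into the three parts A (drift), B (approximation of
I) and D (the difference of Z and the step process). The squares of each sum to
at most delta^2 / 36, so those of V - U sum to at most 9 delta^2 / 36 and
|V - U| <= delta / 2. The remaining delta / 2 is for the quadratic variation
and the Riemann sum, delta^2 / 8 each. *)
Lemma sigma_hat_close : `|Sigma_hat eps n t X w - Sigma_limit T sigma xS| <= delta.
Proof.
pose U (i : 'I_n) := g i * (W (t i.+1) w - W (t i) w).
pose V (i : 'I_n) := eps^-1 * (X (t i.+1) w - X (t i) w).
have hatE : Sigma_hat eps n t X w = Num.sqrt (\sum_i V i ^+ 2).
  rewrite /Sigma_hat mulr_sumr; congr Num.sqrt; apply: eq_bigr => i _.
  by rewrite real_normK ?num_real// /V exprMn exprVn.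
have q0 : 0 <= \int[mu]_(s in `[0, T]) sigma (xS s) ^+ 2.
  by apply: Rintegral_ge0 => s _; exact: sqr_ge0.
have d0 : 0 <= delta := ltW delta0.
have half : delta / 2 = Num.sqrt ((delta / 2) ^+ 2).
  by rewrite sqrtr_sqr ger0_norm// divr_ge0.
have h1 : `|Num.sqrt (\sum_i U i ^+ 2) - Sigma_limit T sigma xS| <= delta / 2.
  rewrite (le_trans (sqrt_dist _ q0))//; first by apply: sumr_ge0 => i _; exact: sqr_ge0.
  rewrite [leRHS]half ler_sqrt ?sqr_ge0//.
  have -> : \sum_i U i ^+ 2 = \sum_(i < n) g i ^+ 2 * (W (t i.+1) w - W (t i) w) ^+ 2.
    by apply: eq_bigr => i _; rewrite /U exprMn.
  have := QV; have := riemann_small.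
  set p := \sum_(i < n) _ * (_ - _); set q := \int[mu]_(_ in _) _.
  set r := \sum_(i < n) _ * _ ^+ 2 => pq rp.
  have -> : r - q = (r - p) + (p - q) by ring.
  rewrite (le_trans (ler_normD _ _))//; lra.
have h2 : Num.sqrt (\sum_i (V i - U i) ^+ 2) <= delta / 2.
  rewrite [leRHS]half ler_sqrt ?sqr_ge0//.
  pose N i := simple_integral W Z (t i) w.
  pose A i := eps^-1 * (\int[mu]_(s in `[0, t i.+1]) S (X s w) -
                        \int[mu]_(s in `[0, t i]) S (X s w)).
  pose B i := (I (t i.+1) w - I (t i) w) - (N i.+1 - N i).
  pose D i := (N i.+1 - N i) - g i * (W (t i.+1) w - W (t i) w).
  have E (i : 'I_n) : V i - U i = A i + B i + D i.
    have ni := ltn_ord i; rewrite /V /U !XE ?tI// 1?ltnW// /A /B /D.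
    by field; rewrite gt_eqF.
  have le3 (i : 'I_n) : (V i - U i) ^+ 2 <= 3 * (A i ^+ 2 + B i ^+ 2 + D i ^+ 2).
    rewrite E; have := sqr_ge0 (A i - B i); have := sqr_ge0 (A i - D i).
    have := sqr_ge0 (B i - D i); lra.
  apply: (le_trans (ler_sum _ (fun i _ => le3 i))).
  rewrite -mulr_sumr !big_split/=.
  have hD : \sum_(i < n) D i ^+ 2 <= delta ^+ 2 / 36 by exact: blocks_small.
  have hB : \sum_(i < n) B i ^+ 2 <= delta ^+ 2 / 36.
    apply: le_trans small_eta.
    rewrite -[n in n%:R]card_ord -sum1_card natr_sum mulr_suml.
    apply: ler_sum => i _; rewrite mul1r -(real_normK (num_real (B i))).
    rewrite ler_sqr ?nnegrE ?mulr_ge0//.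
    have ni := ltn_ord i; have e1 := NI (tI ni); have e2 := NI (tI (ltnW ni)).
    have -> : B i = (N i - I (t i) w) - (N i.+1 - I (t i.+1) w) by rewrite /B; ring.
    by rewrite (le_trans (ler_normB _ _))//; rewrite /N; lra.
  have hA : \sum_(i < n) A i ^+ 2 <= delta ^+ 2 / 36.
    have cSX : {within `[0, T], continuous (fun s => S (X s w))}.
      exact: lipschitz_within_continuous lS cX.
    have SMC s : 0 <= s <= T -> `|S (X s w)| <= M + C.
      move=> sI; have -> : S (X s w) = S (xS s) + (S (X s w) - S (xS s)) by ring.
      rewrite (le_trans (ler_normD _ _))// lerD ?SM//.
      rewrite (le_trans (lS _ _))// ler_piMr ?(ltW C0)//.
      by rewrite (le_trans (path_close sI))// ltW.
    have Ai (i : 'I_n) : A i ^+ 2 <= eps ^- 2 * ((M + C) ^+ 2 * h * (t i.+1 - t i)).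
      have ni := ltn_ord i.
      have /andP[ti0 _] := tI (ltnW ni); have /andP[_ tiT] := tI ni.
      have tii : t i <= t i.+1 by case: tP => _ _ /(_ _ ni)/ltW.
      have := integral_bound_itv ti0 tii tiT cSX SMC.
      rewrite /A exprMn exprVn; set J := _ - _ => hJ.
      rewrite ler_wpM2l ?invr_ge0 ?sqr_ge0// -(real_normK (num_real J)).
      have dt0 : 0 <= t i.+1 - t i by rewrite subr_ge0.
      have MC0 : 0 <= M + C by rewrite addr_ge0// ltW.
      apply: (@le_trans _ _ (((M + C) * (t i.+1 - t i)) ^+ 2)).
        by rewrite ler_sqr ?nnegrE// mulr_ge0.
      rewrite exprMn -mulrA ler_wpM2l ?sqr_ge0// expr2 ler_wpM2r//.
      exact: th.
    apply: (le_trans (ler_sum _ (fun i _ => Ai i))).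
    rewrite -!mulr_sumr -(big_mkord xpredT (fun i => t i.+1 - t i)) telescope_sumr//.
    case: (tP) => -> -> _; rewrite subr0.
    rewrite mulrC ler_pdivrMr ?exprn_gt0//.
    by rewrite (le_trans small_drift)// mulrC.
  lra.
rewrite hatE; have := sqrt_sum_sqr_dist V U.
have -> : Num.sqrt (\sum_i V i ^+ 2) - Sigma_limit T sigma xS =
  (Num.sqrt (\sum_i V i ^+ 2) - Num.sqrt (\sum_i U i ^+ 2)) +
  (Num.sqrt (\sum_i U i ^+ 2) - Sigma_limit T sigma xS) by ring.
move=> h3; rewrite (le_trans (ler_normD _ _))//; lra.
Qed.

End good_path.

(** * Probability of a deviation, and conclusion *)

(** The constant a is chosen so that the maximal inequality has probability
b / a^2 = kappa. *)
Section fixed_noise_level.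
Context d (Omega : measurableType d) (R : realType) (P : probability Omega R).
Variables (T x0 C M eps : R) (F : R -> set (set Omega)).
Variables (W X : R -> Omega -> R) (S sigma xS : R -> R).
Variables (n : nat) (t : nat -> R) (h delta kappa : R).
Local Notation mu := (@lebesgue_measure R).
Hypotheses (T0 : 0 < T) (C0 : 0 < C) (M0 : 0 <= M) (eps0 : 0 < eps).
Hypotheses (FT : is_filtration T F) (WT : is_wiener P T F W).
Hypotheses (lS : is_lipschitz C S) (lsigma : is_lipschitz C sigma).
Hypothesis xS_ode : ode_solution T x0 S xS.
Hypothesis SM : forall s, 0 <= s <= T -> `|S (xS s)| <= M.
Hypothesis sigmaM : forall s, 0 <= s <= T -> `|sigma (xS s)| <= M.
Hypothesis X_sde : sde_solution P T x0 eps F W S sigma X.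
Hypothesis tP : is_partition T n t.
Hypothesis th : forall i, (i < n)%N -> t i.+1 - t i <= h.
Hypotheses (delta0 : 0 < delta) (kappa0 : 0 < kappa).
Let b := 2 * T * (M + C) ^+ 2 + 2.
Let a := Num.sqrt (b / kappa).
Let L := 2 * (a + 1) * expR (2 * C * T).
Hypothesis small_path : L * eps < 1.
Hypothesis small_drift : (M + C) ^+ 2 * h * T <= eps ^+ 2 * (delta ^+ 2 / 36).
Hypothesis small_riemann : 2 * M * (C * (M * h)) * T <= delta ^+ 2 / 8.
Hypothesis small_blocks :
  2 * (T * (C * (L * eps) + C * (M * h)) ^+ 2) <= kappa * (delta ^+ 2 / 72).
Hypothesis small_qv : 57 * (M ^+ 4 * h * T) <= kappa * (delta ^+ 2 / 8) ^+ 2.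

Lemma measurable_Sigma_hat : measurable_fun setT (Sigma_hat eps n t X).
Proof.
have [[_ aX] _] := X_sde.
have mX i : (i <= n)%N -> measurable_fun setT (X (t i)).
  move=> ni; have tI := partition_itv tP ni.
  by apply: (rv_measurable_at FT tI); exact: aX.
apply: (measurableT_comp (continuous_measurable_fun (@sqrt_continuous R))).
apply: measurable_funM => //; apply: measurable_sum => i.
apply: measurable_funX; apply: measurableT_comp => //.
apply: measurable_funB; first exact: mX (ltn_ord i).
exact: mX (ltnW (ltn_ord i)).
Qed.

Lemma Sigma_hat_deviation :
  (P [set w | (delta < `|Sigma_hat eps n t X w - Sigma_limit T sigma xS|)%R] <=
    (4 * kappa)%:E)%E.
Proof.
have [cX [I [ito [B0 [mB0 PB0 hB0']]]]] := X_sde.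
have hB0 w : ~ B0 w -> forall s, 0 <= s <= T ->
    X s w = x0 + \int[mu]_(u in `[0, s]) S (X u w) + eps * I s w.
  by move=> nB; apply: contrapT => nE; apply/nB/hB0'.
have cxS : {within `[0, T], continuous xS} by case: xS_ode.
have xSE := ode_solution_integral C0 lS xS_ode.
have b2 : 2 <= b by rewrite /b lerDr mulr_ge0 ?sqr_ge0// mulr_ge0// ltW.
have b0 : 0 < b by exact: lt_le_trans b2.
have a0 : 0 < a by rewrite sqrtr_gt0 divr_gt0.
have ba : b / a ^+ 2 = kappa.
  by rewrite sqr_sqrtr ?divr_ge0 ?ltW//; field; rewrite !gt_eqF.
have d36 : 0 < delta ^+ 2 / 36 by rewrite divr_gt0// exprn_gt0.
have d8 : 0 < delta ^+ 2 / 8 by rewrite divr_gt0// exprn_gt0.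
(* The last term uses n: the approximation must be finer than the number of
   increments over which its error is summed. *)
pose eta := Num.min 1 (Num.min (kappa * (delta ^+ 2 / 144)) (delta ^+ 2 / 36 / (4 * n.+1%:R))).
have eta0 : 0 < eta.
  by rewrite !lt_min ltr01 mulr_gt0 ?divr_gt0 ?exprn_gt0// mulr_gt0.
have eta1 : eta <= 1 by rewrite ge_min lexx.
have eta2 : eta <= kappa * (delta ^+ 2 / 144) by rewrite !ge_min lexx orbT.
have eta3 : n%:R * (2 * eta) ^+ 2 <= delta ^+ 2 / 36.
  have e3 : eta <= delta ^+ 2 / 36 / (4 * n.+1%:R) by rewrite !ge_min lexx !orbT.
  move: e3; rewrite ler_pdivlMr; last by rewrite mulr_gt0.
  move=> e3; apply: le_trans e3.
  have -> : n%:R * (2 * eta) ^+ 2 = 4 * n%:R * eta * eta by ring.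
  have nn : (n%:R : R) <= n.+1%:R by rewrite ler_nat.
  have n0 : 0 <= (n%:R : R) by [].
  have : n%:R * eta * eta <= n.+1%:R * eta * 1.
    apply: ler_pM => //; first by rewrite mulr_ge0// ltW.
      exact: ltW.
    by rewrite ler_wpM2r// ltW.
  lra.
have [Z [B1 [ZS mB1 PB1 hB1]]] := ito_approximation T0 FT (wiener_cont_adapted WT) ito eta0 kappa0.
have [B2 [mB2 PB2 hB2]] := simple_integral_maximal T0 FT WT ZS a0 (ltW b0).
pose g i := sigma (xS (t i)).
pose zeta := 2 * eta + 2 * (T * (C * (L * eps) + C * (M * h)) ^+ 2).
have zeta0 : 0 <= zeta.
  apply: addr_ge0; rewrite mulr_ge0// ?(ltW eta0)//.
  by rewrite mulr_ge0 ?sqr_ge0// ltW.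
have [B3 [mB3 PB3 hB3]] := simple_integral_blocks T0 FT WT ZS
  (step_process_simple (n := n) (t := t) g tP F) tP d36 zeta0.
have [B4 [mB4 PB4 hB4]] := quadratic_variation_bound FT WT g tP d8.
have PB2' : (P B2 <= kappa%:E)%E by rewrite (le_trans PB2)// ba.
have PB3' : (P B3 <= kappa%:E)%E.
  rewrite (le_trans PB3)// lee_fin ler_pdivrMr// /zeta.
  have -> : kappa * (delta ^+ 2 / 36) =
    2 * (kappa * (delta ^+ 2 / 144)) + kappa * (delta ^+ 2 / 72) by field.
  by apply: lerD => //; rewrite ler_wpM2l.
have PB4' : (P B4 <= kappa%:E)%E.
  rewrite (le_trans PB4)// lee_fin ler_pdivrMr ?exprn_gt0//.
  apply: le_trans small_qv; rewrite ler_wpM2l//.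
  have -> : M ^+ 4 * h * T = \sum_(i < n) M ^+ 4 * h * (t i.+1 - t i).
    rewrite -mulr_sumr -(big_mkord xpredT (fun i => t i.+1 - t i)) telescope_sumr//.
    by case: (tP) => -> -> _; rewrite subr0.
  apply: ler_sum => i _; have ni := ltn_ord i.
  have ti : 0 <= t i.+1 - t i by rewrite subr_ge0 ltW//; case: tP => _ _; exact.
  rewrite [_ ^+ 2]expr2 mulrA ler_wpM2r// ler_pM// ?exprn_even_ge0//; last exact: th.
  have gM : `|g i| <= M by apply/sigmaM/(partition_itv tP)/ltnW.
  have -> : g i ^+ 4 = `|g i| ^+ 4.
    by rewrite -[4%N]/(2 * 2)%N !exprM real_normK ?num_real.
  by rewrite lerXn2r ?nnegrE.
have mD := measurable_gt_event delta (measurableT_comp (@normr_measurable R setT)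
   (measurable_funB measurable_Sigma_hat (measurable_cst (Sigma_limit T sigma xS)))).
pose B := B0 `|` (B1 `|` (B2 `|` (B3 `|` B4))).
have mB : measurable B by do 4 apply: measurableU => //.
apply: (@le_trans _ _ (P B)).
  apply: le_measure; rewrite ?inE// => w /= wD.
  apply: contrapT => /not_orP[n0 /not_orP[n1 /not_orP[n2 /not_orP[n3 n4]]]].
  have [NI ZH] := hB1 w n1.
  move: wD; apply/negP; rewrite -leNgt.
  apply: (sigma_hat_close T0 C0 M0 eps0 lS lsigma cxS xSE SM sigmaM
     (cX.1 w) _ (hB0 w n0) (ltW a0) (ltW eta0) eta1 NI ZH erefl (hB2 w n2)
     small_path tP th delta0 (hB3 w n3) (hB4 w n4) eta3 small_drift small_riemann).
  by case: ito => _ [cI _] _; exact: cI.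
(* The null set B0 carries the exceptional paths of the equation itself. *)
have -> : (4 * kappa)%:E = (0%:E + (kappa%:E + (kappa%:E + (kappa%:E + kappa%:E))))%E.
  by rewrite -!EFinD; congr EFin; ring.
rewrite (le_trans (measureU2 _ _ _))//; first by do 3 apply: measurableU => //.
apply: leeD; first by have /eqP := PB0; rewrite eq_le => /andP[].
rewrite (le_trans (measureU2 _ _ _))//; first by do 2 apply: measurableU => //.
apply: leeD => //.
rewrite (le_trans (measureU2 _ _ _))//; first by apply: measurableU.
apply: leeD => //.
rewrite (le_trans (measureU2 _ _ _))//.
exact: leeD.
Qed.

End fixed_noise_level.

Section convergence.
Context (R : realType).

Lemma ge0_cvge0P (J : Type) (G : set_system J) (f : J -> \bar R) : Filter G ->
  (forall j, (0 <= f j)%E) ->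
  (forall kappa : R, 0 < kappa -> \forall j \near G, (f j <= kappa%:E)%E) ->
  f @ G --> 0%E.
Proof.
move=> FG f0 fle; apply/fine_cvgP; split.
  have := fle 1 ltr01; apply: filterS => j fj.
  by rewrite ge0_fin_numE// (le_lt_trans fj)// ltry.
apply/cvgrPdist_le => kappa kappa0; have := fle kappa kappa0; apply: filterS => j.
rewrite sub0r normrN /=; have := f0 j; case: (f j) => //= r.
by rewrite !lee_fin => r0 rk; rewrite ger0_norm.
Qed.

Lemma near0_mul_le (K c : R) : 0 < c -> \forall x \near 0^'+, K * x <= c.
Proof.
move=> c0; have K1 : 0 < `|K| + 1 by rewrite ltr_wpDl.
near=> x.
have x0 : 0 < x by near: x; exact: nbhs_right_gt.
have : x <= c / (`|K| + 1) by near: x; apply: nbhs_right_le; rewrite divr_gt0.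
rewrite ler_pdivlMr// => h; apply: le_trans h.
by rewrite mulrC ler_wpM2l ?(ltW x0)// (le_trans (ler_norm _))// lerDl.
Unshelve. all: by end_near. Qed.

End convergence.

Theorem theorem9 (R : realType) (d : measure_display) (Omega : measurableType d)
    (P : probability Omega R) (T x0 : R) (F : R -> set (set Omega))
    (W : R -> Omega -> R) (S sigma xS : R -> R)
    (X : R -> R -> Omega -> R) (n : R -> nat) (t : R -> nat -> R)
    (T_gt0 : 0 < T)
    (F_filtration : is_filtration T F)
    (W_wiener : is_wiener P T F W)
    (A1 : exists2 C : R, 0 < C & is_lipschitz C S /\ is_lipschitz C sigma)
    (X_sde : forall eps : R, 0 < eps ->
       sde_solution P T x0 eps F W S sigma (X eps))
    (xS_ode : ode_solution T x0 S xS)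
    (t_partition : forall eps : R, 0 < eps -> is_partition T (n eps) (t eps))
    (t_mesh : (fun eps : R => mesh (n eps) (t eps)) =o_ (0^'+)
              (fun eps : R => eps ^+ 2))
    (X_moment : forall eps : R, 0 < eps ->
       (ereal_sup [set 'E_P[(fun w => `|X eps s w| ^+ 4)%R] | s in `[0%R, T]]
          < +oo)%E) :
  cvg_in_probability P (0^'+)
    (fun eps => Sigma_hat eps (n eps) (t eps) (X eps))
    (cst (Sigma_limit T sigma xS)).
Proof.
case: A1 => C C0 [lS lsigma] delta delta0.
have cxS : {within `[0, T], continuous xS} by case: xS_ode.
have [M1 M10 SM1] := within_continuous_bounded (ltW T_gt0)
  (lipschitz_within_continuous C0 lS cxS).
have [M2 M20 sM2] := within_continuous_bounded (ltW T_gt0)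
  (lipschitz_within_continuous C0 lsigma cxS).
pose M := M1 + M2.
have M0 : 0 <= M by exact: addr_ge0.
have SM s : 0 <= s <= T -> `|S (xS s)| <= M.
  by move=> sT; rewrite (le_trans (SM1 s sT))// lerDl.
have sM s : 0 <= s <= T -> `|sigma (xS s)| <= M.
  by move=> sT; rewrite (le_trans (sM2 s sT))// lerDr.
apply: ge0_cvge0P => // k k0.
pose kappa := k / 4.
have kappa0 : 0 < kappa by rewrite divr_gt0.
have -> : k%:E = (4 * kappa)%:E by rewrite /kappa; congr EFin; field.
have d2 : 0 < delta ^+ 2 by rewrite exprn_gt0.
pose L := 2 * (Num.sqrt ((2 * T * (M + C) ^+ 2 + 2) / kappa) + 1) * expR (2 * C * T).
have MC : 0 < (M + C) ^+ 2 by rewrite exprn_gt0// ltr_wpDl.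
(* The threshold that the drift imposes on h / eps^2; the other conditions only
   need h <= eps. *)
pose theta := Num.min 1 (delta ^+ 2 / 36 / ((M + C) ^+ 2 * T)).
have theta0 : 0 < theta by rewrite lt_min ltr01 !divr_gt0// mulr_gt0.
have mesh_small := (eqoP _ _ _).1 t_mesh theta theta0.
near=> eps.
have eps0 : 0 < eps by near: eps; exact: nbhs_right_gt.
have eps1 : eps <= 1 by near: eps; exact: nbhs_right_le.
have h_le : `|mesh (n eps) (t eps)| <= theta * `|eps ^+ 2|.
  by near: eps; exact: mesh_small.
set h := mesh _ _ in h_le *.
have e2 : 0 <= eps ^+ 2 := sqr_ge0 _.
rewrite (ger0_norm e2) in h_le.
have {}h_le : h <= theta * eps ^+ 2 := le_trans (ler_norm _) h_le.
have th i : (i < n eps)%N -> t eps i.+1 - t eps i <= h.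
  move=> ni; apply: (le_trans (ler_norm _)).
  exact: (le_bigmax 0 (fun i : 'I_(n eps) => `|t eps i.+1 - t eps i|) (Ordinal ni)).
have h_eps : h <= eps.
  rewrite (le_trans h_le)// (@le_trans _ _ (1 * eps ^+ 2))//.
    by rewrite ler_wpM2r// ge_min lexx.
  by rewrite mul1r expr2 ler_piMr// ltW.
have h0 : 0 <= h by exact: bigmax_ge_id.
have L0 : 0 <= L.
  by apply: mulr_ge0; rewrite ?expR_ge0// mulr_ge0// addr_ge0// sqrtr_ge0.
apply: (Sigma_hat_deviation T_gt0 C0 M0 eps0 F_filtration W_wiener lS lsigma xS_ode
  SM sM (X_sde _ eps0) (t_partition _ eps0) th delta0 kappa0).
- have : L * eps <= 2^-1 by near: eps; apply: near0_mul_le.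
  by move=> /le_lt_trans; apply; lra.
- have hth : h <= delta ^+ 2 / 36 / ((M + C) ^+ 2 * T) * eps ^+ 2.
    by rewrite (le_trans h_le)// ler_wpM2r// ge_min lexx orbT.
  have MCT : 0 <= (M + C) ^+ 2 * T by rewrite mulr_ge0// ltW.
  have := ler_wpM2l MCT hth.
  rewrite [X in X <= _ -> _](_ : _ = (M + C) ^+ 2 * h * T); last by ring.
  move=> /le_trans; apply; rewrite le_eqVlt; apply/orP; left; apply/eqP.
  by field; rewrite !gt_eqF// ltr_wpDl.
- have : 2 * M * (C * M) * T * eps <= delta ^+ 2 / 8.
    by near: eps; apply: near0_mul_le; rewrite divr_gt0.
  apply: le_trans.
  have -> : 2 * M * (C * (M * h)) * T = 2 * M * (C * M) * T * h by ring.
  by rewrite ler_wpM2l// !mulr_ge0// ltW.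
- have : 2 * (T * (C * L + C * M) ^+ 2) * eps <= kappa * (delta ^+ 2 / 72).
    by near: eps; apply: near0_mul_le; rewrite mulr_gt0// divr_gt0.
  apply: le_trans.
  have CLM : 0 <= C * L + C * M by rewrite addr_ge0// mulr_ge0// ltW.
  have -> : 2 * (T * (C * L + C * M) ^+ 2) * eps = 2 * (T * ((C * L + C * M) ^+ 2 * eps)) by ring.
  rewrite ler_wpM2l// ler_wpM2l ?(ltW T_gt0)//.
  apply: (@le_trans _ _ (((C * L + C * M) * eps) ^+ 2)).
    rewrite ler_sqr ?nnegrE.
    + have -> : (C * L + C * M) * eps = C * (L * eps) + C * (M * eps) by ring.
      by rewrite lerD// ler_wpM2l ?(ltW C0)// ler_wpM2l.
    + apply: addr_ge0; apply: mulr_ge0; rewrite ?(ltW C0)//.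
        by apply: mulr_ge0; [exact: L0|exact: ltW].
      exact: mulr_ge0.
    + by rewrite mulr_ge0// ltW.
  by rewrite exprMn ler_wpM2l ?sqr_ge0// expr2 ler_piMr// ltW.
- have : 57 * (M ^+ 4 * T) * eps <= kappa * (delta ^+ 2 / 8) ^+ 2.
    by near: eps; apply: near0_mul_le; rewrite mulr_gt0// exprn_gt0// divr_gt0.
  apply: le_trans.
  have -> : 57 * (M ^+ 4 * h * T) = 57 * (M ^+ 4 * T) * h by ring.
  by rewrite ler_wpM2l// !mulr_ge0 ?exprn_ge0// ltW.
Unshelve. all: by end_near. Qed.
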